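(* Let $\mathfrak R$ be a complete, separated, right linear topological ring. Then the following conditions are equivalent: (1) the free left $\mathfrak R$-contramodule with one generator $\mathfrak R$ decomposes, in the category of left $\mathfrak R$-contramodules, as a coproduct of $\mathfrak R$-contramodules with local endomorphism rings; (2) the right $\mathfrak R$-module $\mathfrak R$, viewed as a topological right $\mathfrak R$-module, decomposes as a direct product of topological right $\mathfrak R$-modules with local endomorphism rings (with the product topology on the direct product); (3) there exist a set $Z$ and a zero-convergent family of elements $(e_z\in\mathfrak R)_{z\in Z}$ such that $(e_z)_{z\in Z}$ is a family of pairwise orthogonal idempotents, $\sum_{z\in Z}e_z=1$ in $\mathfrak R$, and $e_z\mathfrak R e_z$ is a local ring for every $z\in Z$.
   Context: All rings are associative and unital. A topological ring $\mathfrak R$ is right linear if open right ideals form a base of neighborhoods of zero; it is complete and separated if the natural map $\mathfrak R\to\varprojlim_{\mathfrak I}\mathfrak R/\mathfrak I$ (over open right ideals) is bijective. A family $(r_x)_{x\in X}$ in $\mathfrak R$ is zero-convergent if every open right ideal contains $r_x$ for all but finitely many $x$; infinite sums of zero-convergent families are limits of finite partial sums. A nonzero ring is local if its noninvertible elements form an additive subgroup; locality of rings is understood in the abstract sense, ignoring any topology. Contramodules: for a set $X$, $\mathfrak R[[X]]$ is the set of formal sums $\sum_{x\in X}r_xx$ with $(r_x)$ a zero-convergent family in $\mathfrak R$. For a map $f:X\to Y$, $\mathfrak R[[f]]$ sends $\sum_x r_xx$ to $\sum_y\bigl(\sum_{f(x)=y}r_x\bigr)y$. The functor $X\mapsto\mathfrak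 R[[X]]$ is a monad on sets, with unit $\epsilon_X:x\mapsto 1\cdot x$ and multiplication $\phi_X:\mathfrak R[[\mathfrak R[[X]]]]\to\mathfrak R[[X]]$ (''opening of parentheses'') $\sum_i r_i\bigl(\sum_x s_{i,x}x\bigr)\mapsto\sum_x\bigl(\sum_i r_is_{i,x}\bigr)x$. A left $\mathfrak R$-contramodule is an algebra over this monad, i.e. a set $\mathfrak C$ with a contraaction map $\pi_{\mathfrak C}:\mathfrak R[[\mathfrak C]]\to\mathfrak C$ such that $\pi_{\mathfrak C}\circ\mathfrak R[[\pi_{\mathfrak C}]]=\pi_{\mathfrak C}\circ\phi_{\mathfrak C}$ and $\pi_{\mathfrak C}\circ\epsilon_{\mathfrak C}=\mathrm{id}$; morphisms are morphisms of algebras over the monad. Left $\mathfrak R$-contramodules form an abelian category with products and coproducts. The free contramodules are $\mathfrak R[[X]]$ with contraaction $\phi_X$; the free contramodule with one generator is $\mathfrak R$ itself. A topological right $\mathfrak R$-module here is a right $\mathfrak R$-module with a complete separated topology in which open submodules form a base of neighborhoods of zero and such that the action map is continuous; its endomorphism ring is the ring of continuous $\mathfrak R$-module endomorphisms. *)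

(* Defs.v *)
From HB Require Import structures.
From mathcomp Require Import all_boot all_algebra finmap.
From mathcomp Require Import all_classical.
From mathcomp Require Import topology tvs.
From mathcomp.analysis.showcase Require summability.

Set Implicit Arguments.
Unset Strict Implicit.
Unset Printing Implicit Defensive.

Import GRing.Theory.
Local Open Scope classical_set_scope.
Local Open Scope ring_scope.

Section Linear.
Variable M : zmodType.

Definition coset (I : set M) (m : M) : set M := [set m + i | i in I].

(* An element of the projective limit of the quotients M / I, for I in B, is a
   family of cosets c I; the transition map M / I -> M / J, for I included in
   J, sends c I to the only coset of J that contains it. *)
Definition inverse_limit (B : set (set M)) : set ({I | B I} -> set M) :=
  [set c | (forall I, exists m, c I = coset (sval I) m) /\
           (forall I J, sval I `<=` sval J -> c I `<=` c J)].

Definition complete_separated (B : set (set M)) :=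
  set_bij [set: M] (inverse_limit (B := B)) (fun m I => coset (sval I) m).

Definition additive_subgroup (I : set M) :=
  I 0 /\ forall x y, I x -> I y -> I (x - y).

End Linear.

Definition invertible (A : pzRingType) (x : A) :=
  exists y, x * y = 1 /\ y * x = 1.

Definition local_ring (A : pzRingType) :=
  (1 : A) <> 0 /\ additive_subgroup [set x : A | ~ invertible x].

Definition right_ideal (R : pzRingType) (I : set R) :=
  additive_subgroup I /\ forall x a, I x -> I (x * a).

HB.mixin Record isTopologicalRing R & GRing.PzRing R & TopologicalZmodule R := {
  ring_mul_continuous : continuous (fun x : R * R => x.1 * x.2)
}.

#[short(type="topPzRingType")]
HB.structure Definition TopPzRing :=
  {R of GRing.PzRing R & TopologicalZmodule R & isTopologicalRing R}.

Definition open_right_ideal (R : topPzRingType) : set (set R) :=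
  [set I | open I /\ right_ideal I].

HB.mixin Record isCompleteRightLinear R & TopPzRing R := {
  open_right_ideal_base : forall U : set R, nbhs (0 : R) U ->
    exists2 I, open_right_ideal I & I `<=` U;
  ring_complete_separated : complete_separated (open_right_ideal (R := R))
}.

#[short(type="completeRightLinearType")]
HB.structure Definition CompleteRightLinear :=
  {R of TopPzRing R & isCompleteRightLinear R}.

Definition submodule (R : pzRingType) (M : zmodType) (act : M -> R -> M)
    (N : set M) :=
  additive_subgroup N /\ forall m a, N m -> N (act m a).

Record topRightModule (R : topPzRingType) := TopRightModule {
  trm_sort :> topologicalZmodType;
  ract : trm_sort -> R -> trm_sort;
  ractA : forall m a b, ract (ract m a) b = ract m (a * b);
  ract1 : forall m, ract m 1 = m;
  ractDl : forall m n a, ract (m + n) a = ract m a + ract n a;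
  ractDr : forall m a b, ract m (a + b) = ract m a + ract m b;
  ract_continuous : continuous (fun x : trm_sort * R => ract x.1 x.2);
  open_submodule_base : forall U : set trm_sort, nbhs (0 : trm_sort) U ->
    exists2 N : set trm_sort, open N /\ submodule ract N & N `<=` U;
  module_complete_separated :
    complete_separated [set N : set trm_sort | open N /\ submodule ract N]
}.

Section InfiniteSums.
Variable R : completeRightLinearType.
Implicit Types X Y : Type.

Definition zero_convergent X (r : X -> R) :=
  forall I, open_right_ideal I -> finite_set [set x | ~ I (r x)].

Definition has_sum X (r : X -> R) (s : R) :=
  summability.partial_sum (r : {classic X} -> R) @ summability.totally --> s.

Definition infsum X (r : X -> R) : R := xget 0 [set s | has_sum r s].

Let partial_sumE X (r : X -> R) (B : {fset {classic X}}) :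
  summability.partial_sum (r : {classic X} -> R) B = \sum_(x <- B) r x.
Proof. by rewrite /summability.partial_sum big_seq_fsetE. Qed.

Section Ideal.
Variables (I : set R) (oI : open_right_ideal I).
Lemma ori0 : I 0. Proof. by case: oI => _ [[]]. Qed.
Lemma oriB x y : I x -> I y -> I (x - y).
Proof. by case: oI => _ [[_ +] _]; apply. Qed.
Lemma oriN x : I x -> I (- x).
Proof. by move=> ix; rewrite -[- x]add0r; apply: oriB => //; exact: ori0. Qed.
Lemma oriD x y : I x -> I y -> I (x + y).
Proof. by move=> ix iy; rewrite -[y]opprK; apply: oriB => //; exact: oriN. Qed.
Lemma oriM x a : I x -> I (x * a).
Proof. by case: oI => _ [_]; apply. Qed.
Lemma ori_sum X (s : seq X) (P : pred X) (f : X -> R) :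
  (forall x, P x -> I (f x)) -> I (\sum_(x <- s | P x) f x).
Proof. by move=> h; elim/big_ind: _ => //; [exact: ori0|exact: oriD]. Qed.
Lemma ori_nbhs (s : R) : nbhs s [set t | I (t - s)].
Proof.
have c : {for s, continuous (fun t : R => t - s)}.
  apply: (@continuous_comp _ _ _ (fun t : R => (t, s)) (fun x : R * R => x.1 - x.2)).
    by apply: cvg_pair => /=; [exact: cvg_id|exact: cvg_cst].
  exact: sub_continuous.
apply: c; rewrite subrr; apply: open_nbhs_nbhs; split; last exact: ori0.
by case: oI.
Qed.
End Ideal.

Lemma ori_base (s : R) (U : set R) : nbhs s U ->
  exists2 I, open_right_ideal I & forall t, I (t - s) -> U t.
Proof.
move=> Us; have c : {for (0 : R), continuous (fun t : R => t + s)}.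
  apply: (@continuous_comp _ _ _ (fun t : R => (t, s)) (fun x : R * R => x.1 + x.2)).
    by apply: cvg_pair => /=; [exact: cvg_id|exact: cvg_cst].
  exact: add_continuous.
have /open_right_ideal_base [I oI IU] : nbhs (0 : R) [set t | U (t + s)].
  by apply: c; rewrite add0r.
by exists I => // t /IU /=; rewrite subrK.
Qed.

Lemma ori_setT : open_right_ideal [set: R].
Proof. by split; [exact: openT|]. Qed.

Lemma ori_lmul (a : R) I : open_right_ideal I ->
  exists2 J, open_right_ideal J & forall x, J x -> I (a * x).
Proof.
move=> oI; have c : {for (0 : R), continuous (fun t : R => a * t)}.
  apply: (@continuous_comp _ _ _ (fun t : R => (a, t)) (fun x : R * R => x.1 * x.2)).
    by apply: cvg_pair => /=; [exact: cvg_cst|exact: cvg_id].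
  exact: ring_mul_continuous.
have /open_right_ideal_base [J oJ JU] : nbhs (0 : R) [set t | I (a * t)].
  apply: c; rewrite mulr0; apply: open_nbhs_nbhs.
  by split; [case: oI|exact: ori0].
by exists J.
Qed.

Lemma ori_coset I (x y : R) : open_right_ideal I ->
  I (x - y) -> coset I x = coset I y.
Proof.
move=> oI ixy; apply/seteqP; split => _ [i Ii <-].
  by exists (x - y + i); [exact: oriD|rewrite addrA subrKC].
exists (- (x - y) + i); first by apply: oriD => //; exact: oriN.
by rewrite addrA opprB subrKC.
Qed.

Lemma coset_ori I (x y : R) : open_right_ideal I ->
  coset I x = coset I y -> I (x - y).
Proof.
move=> oI e; have : coset I x x by exists 0; [exact: ori0|rewrite addr0].
by rewrite e => -[i Ii <-]; rewrite addrAC subrr add0r.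
Qed.

Lemma ori_separated (s t : R) :
  (forall I, open_right_ideal I -> I (s - t)) -> s = t.
Proof.
move=> h; have [_ inj _] := @ring_complete_separated R.
apply: inj; rewrite ?inE //; apply: functional_extensionality_dep => -[I oI] /=.
by apply: ori_coset => //; exact: h.
Qed.

Lemma zero_convergentP X (r : X -> R) :
  zero_convergent r <-> forall I, open_right_ideal I ->
    exists B : {fset {classic X}}, forall x, (x : {classic X}) \notin B -> I (r x).
Proof.
split=> h I oI.
  have /(@finite_fsetP {classic X})[B BE] := h I oI.
  exists B => x xB; apply: contrapT => nI; move/negP: xB; apply.
  by have : [set` B] x by rewrite -BE.
have [B hB] := h I oI.
apply: (@sub_finite_set {classic X} _ [set` B]); last exact: finite_fset.
by move=> x /= nI; apply/negPn/negP => /hB.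
Qed.

Lemma has_sumP X (r : X -> R) (s : R) :
  has_sum r s <-> forall I, open_right_ideal I ->
    exists B : {fset {classic X}}, forall C : {fset {classic X}}, (B `<=` C)%fset ->
      I (\sum_(x <- C) r x - s).
Proof.
split=> [h I oI|h U Us].
  have [B _ hB] := h _ (ori_nbhs oI s).
  by exists B => C BC; have := hB C BC; rewrite /= partial_sumE.
have [I oI IU] := ori_base Us; have [B hB] := h I oI.
by exists B => // C BC; rewrite /= partial_sumE; apply/IU/hB.
Qed.

Lemma sum_diff X (r : X -> R) (B C : {fset {classic X}}) I :
  open_right_ideal I -> (B `<=` C)%fset ->
  (forall x, (x : {classic X}) \notin B -> I (r x)) ->
  I (\sum_(x <- C) r x - \sum_(x <- B) r x).
Proof.
move=> oI BC hB; rewrite (big_fsetID _ (fun x => x \in B)) /=.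
have -> : [fset x in C | x \in B]%fset = B.
  by apply/fsetP => x; rewrite !inE /= andb_idl //; exact: (fsubsetP BC).
rewrite addrAC subrr add0r big_seq; apply: ori_sum => // x.
by rewrite !inE /= => /andP[_ /hB].
Qed.

Lemma has_sum_ex X (r : X -> R) : zero_convergent r -> exists s, has_sum r s.
Proof.
move=> /zero_convergentP zr.
have /choice[F hF] : forall I : {I | open_right_ideal (R := R) I},
    exists B : {fset {classic X}}, forall x, (x : {classic X}) \notin B -> sval I (r x).
  by move=> [I oI]; exact: zr.
pose c (I : {I | open_right_ideal (R := R) I}) :=
  coset (sval I) (\sum_(x <- F I) r x).
have [_ _ surj] := @ring_complete_separated R.
have : inverse_limit (B := open_right_ideal (R := R)) c.
  split=> [I|I J IJ]; first by eexists.
  have oI := svalP I; have oJ := svalP J.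
  rewrite /c => _ [i Ii <-].
  rewrite (@ori_coset (sval J) _ (\sum_(x <- F I) r x)) //.
    by exists i => //; exact: IJ.
  pose G := (F I `|` F J)%fset.
  have d1 : sval J (\sum_(x <- G) r x - \sum_(x <- F J) r x).
    by apply: sum_diff (hF J) => //; exact: fsubsetUr.
  have d2 : sval J (\sum_(x <- G) r x - \sum_(x <- F I) r x).
    apply: sum_diff => //; first exact: fsubsetUl.
    by move=> x /hF /IJ.
  have := oriB oJ d2 d1.
  by rewrite opprB addrC addrA subrK.
move=> /surj [s _ sE]; exists s; apply/has_sumP => I oI.
pose K : {I | open_right_ideal (R := R) I} := exist _ I oI.
exists (F K) => C KC.
have h1 : I (\sum_(x <- C) r x - \sum_(x <- F K) r x) by apply: sum_diff (hF K).
have h2 : I (s - \sum_(x <- F K) r x).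
  by apply: coset_ori => //; move/(congr1 (fun f => f K)): sE.
by have := oriB oI h1 h2; rewrite opprB addrA subrK.
Qed.

Lemma has_sum_near X (r : X -> R) (s : R) I (B : {fset {classic X}}) :
  has_sum r s -> open_right_ideal I ->
  (forall x, (x : {classic X}) \notin B -> I (r x)) ->
  I (s - \sum_(x <- B) r x).
Proof.
move=> /has_sumP h oI hB; have [C hC] := h I oI.
have h1 : I (\sum_(x <- (B `|` C)%fset) r x - s) by apply: hC; exact: fsubsetUr.
have h2 : I (\sum_(x <- (B `|` C)%fset) r x - \sum_(x <- B) r x).
  by apply: sum_diff => //; exact: fsubsetUl.
have := oriB oI h2 h1.
by rewrite opprB addrC addrA subrK.
Qed.

Lemma infsum_near X (r : X -> R) I (B : {fset {classic X}}) :
  zero_convergent r -> open_right_ideal I ->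
  (forall x, (x : {classic X}) \notin B -> I (r x)) ->
  I (infsum r - \sum_(x <- B) r x).
Proof.
move=> /has_sum_ex h oI hB; apply: has_sum_near => //.
exact: (xgetPex 0 h).
Qed.

(* A sum is determined by its values modulo open right ideals. *)
Lemma infsum_eq X (r : X -> R) (s : R) : zero_convergent r ->
  (forall I, open_right_ideal I -> exists2 B : {fset {classic X}},
     (forall x, (x : {classic X}) \notin B -> I (r x)) &
     I (\sum_(x <- B) r x - s)) ->
  infsum r = s.
Proof.
move=> zr h; apply: ori_separated => I oI; have [B hB hs] := h I oI.
have := oriD oI (infsum_near zr oI hB) hs.
by rewrite addrA subrK.
Qed.

Lemma ori_infsum X (r : X -> R) I : zero_convergent r -> open_right_ideal I ->
  (forall x, I (r x)) -> I (infsum r).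
Proof.
move=> zr oI h; have := @infsum_near _ r I fset0%fset zr oI (fun x _ => h x).
by rewrite big_seq_fset0 subr0.
Qed.

End InfiniteSums.

Section SumLemmas.
Variable R : completeRightLinearType.
Implicit Types X Y : Type.

Lemma zero_convergentD X (r s : X -> R) :
  zero_convergent r -> zero_convergent s -> zero_convergent (fun x => r x + s x).
Proof.
move=> /zero_convergentP zr /zero_convergentP zs; apply/zero_convergentP => I oI.
have [B hB] := zr I oI; have [C hC] := zs I oI.
exists (B `|` C)%fset => x; rewrite inE negb_or => /andP[/hB ? /hC ?].
exact: oriD.
Qed.

Lemma zero_convergentN X (r : X -> R) :
  zero_convergent r -> zero_convergent (fun x => - r x).
Proof.
move=> /zero_convergentP zr; apply/zero_convergentP => I oI.
by have [B hB] := zr I oI; exists B => x /hB; exact: oriN.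
Qed.

Lemma zero_convergentMr X (r a : X -> R) :
  zero_convergent r -> zero_convergent (fun x => r x * a x).
Proof.
move=> /zero_convergentP zr; apply/zero_convergentP => I oI.
by have [B hB] := zr I oI; exists B => x /hB; exact: oriM.
Qed.

Lemma zero_convergentMl X (a : R) (r : X -> R) :
  zero_convergent r -> zero_convergent (fun x => a * r x).
Proof.
move=> /zero_convergentP zr; apply/zero_convergentP => I /(ori_lmul a)[J oJ JI].
by have [B hB] := zr J oJ; exists B => x /hB /JI.
Qed.

Lemma zero_convergent_single X (x0 : X) (r : X -> R) :
  (forall x, x <> x0 -> r x = 0) -> zero_convergent r.
Proof.
move=> r0; apply/zero_convergentP => I oI; exists [fset (x0 : {classic X})]%fset => x.
by rewrite inE => /eqP /r0 ->; exact: ori0.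
Qed.

Lemma infsum_single X (x0 : X) (r : X -> R) :
  (forall x, x <> x0 -> r x = 0) -> infsum r = r x0.
Proof.
move=> r0; apply: infsum_eq; first exact: zero_convergent_single r0.
move=> I oI; exists [fset (x0 : {classic X})]%fset.
  by move=> x; rewrite inE => /eqP /r0 ->; exact: ori0.
by rewrite big_seq_fset1 subrr; exact: ori0.
Qed.

Lemma infsum0 X : infsum (fun _ : X => 0 : R) = 0.
Proof.
have z : zero_convergent (fun _ : X => 0 : R).
  by apply/zero_convergentP => I oI; exists fset0 => x _; exact: ori0.
apply: infsum_eq => // I oI; exists fset0 => [x _|]; first exact: ori0.
by rewrite big_seq_fset0 subrr; exact: ori0.
Qed.

Lemma infsumD X (r s : X -> R) : zero_convergent r -> zero_convergent s ->
  infsum (fun x => r x + s x) = infsum r + infsum s.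
Proof.
move=> zr zs; apply: infsum_eq; first exact: zero_convergentD.
move=> I oI.
have [B hB] := (zero_convergentP _).1 zr I oI.
have [C hC] := (zero_convergentP _).1 zs I oI.
have hB' x : (x : {classic X}) \notin (B `|` C)%fset -> I (r x).
  by rewrite inE negb_or => /andP[/hB].
have hC' x : (x : {classic X}) \notin (B `|` C)%fset -> I (s x).
  by rewrite inE negb_or => /andP[_ /hC].
exists (B `|` C)%fset; first by move=> x xBC; apply: oriD; [|exact: hB'|exact: hC'].
rewrite big_split /= opprD addrACA -[X in I X]opprK; apply: oriN => //.
by rewrite opprD !opprB; apply: oriD => //; exact: infsum_near.
Qed.

Lemma infsumN X (r : X -> R) : zero_convergent r ->
  infsum (fun x => - r x) = - infsum r.
Proof.
move=> zr; apply/eqP; rewrite -addr_eq0 -infsumD//; last exact: zero_convergentN.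
apply/eqP; apply: infsum_eq.
  by apply: zero_convergentD => //; exact: zero_convergentN.
move=> I oI; exists fset0 => [x _|]; first by rewrite addNr; exact: ori0.
by rewrite big_seq_fset0 subrr; exact: ori0.
Qed.

Lemma infsumMr X (r : X -> R) (a : R) : zero_convergent r ->
  infsum (fun x => r x * a) = infsum r * a.
Proof.
move=> zr; apply: infsum_eq; first exact: zero_convergentMr.
move=> I oI; have [B hB] := (zero_convergentP _).1 zr I oI.
exists B; first by move=> x /hB; exact: oriM.
by rewrite -mulr_suml -mulrBl; apply: oriM => //; rewrite -opprB; apply: oriN => //;
   exact: infsum_near.
Qed.

Lemma infsumMl X (a : R) (r : X -> R) : zero_convergent r ->
  infsum (fun x => a * r x) = a * infsum r.
Proof.
move=> zr; apply: infsum_eq; first exact: zero_convergentMl.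
move=> I /(ori_lmul a)[J oJ JI]; have [B hB] := (zero_convergentP _).1 zr J oJ.
exists B; first by move=> x /hB /JI.
by rewrite -mulr_sumr -mulrBr; apply: JI; rewrite -opprB; apply: oriN => //;
   exact: infsum_near.
Qed.

Section Double.
Variables (X Y : Type) (r : X -> Y -> R).
Hypothesis zr : zero_convergent (fun p : X * Y => r p.1 p.2).

Lemma zero_convergent_fst x : zero_convergent (r x).
Proof.
apply/zero_convergentP => I oI; have [B hB] := (zero_convergentP _).1 zr I oI.
exists [fset ((p : X * Y).2 : {classic Y}) | p : {classic X * Y} in B]%fset => y yB.
apply: (hB (x, y)); apply: contra yB => xyB.
by apply/imfsetP; exists (x, y).
Qed.

Lemma zero_convergent_snd y : zero_convergent (r^~ y).
Proof.
apply/zero_convergentP => I oI; have [B hB] := (zero_convergentP _).1 zr I oI.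
exists [fset ((p : X * Y).1 : {classic X}) | p : {classic X * Y} in B]%fset => x xB.
apply: (hB (x, y)); apply: contra xB => xyB.
by apply/imfsetP; exists (x, y).
Qed.

Lemma zero_convergent_infsum : zero_convergent (fun x => infsum (r x)).
Proof.
apply/zero_convergentP => I oI; have [B hB] := (zero_convergentP _).1 zr I oI.
exists [fset ((p : X * Y).1 : {classic X}) | p : {classic X * Y} in B]%fset => x xB.
apply: ori_infsum => //; first exact: zero_convergent_fst.
move=> y; apply: (hB (x, y)); apply: contra xB => xyB.
by apply/imfsetP; exists (x, y).
Qed.

Lemma infsum_pair :
  infsum (fun x => infsum (r x)) = infsum (fun p : X * Y => r p.1 p.2).
Proof.
apply: infsum_eq; first exact: zero_convergent_infsum.
move=> I oI; have [B hB] := (zero_convergentP _).1 zr I oI.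
pose B1 := [fset ((p : X * Y).1 : {classic X}) | p : {classic X * Y} in B]%fset.
pose B2 := [fset ((p : X * Y).2 : {classic Y}) | p : {classic X * Y} in B]%fset.
pose pr (x : {classic X}) (y : {classic Y}) : {classic X * Y} := (x, y).
pose L := [seq pr x y | x <- B1, y <- B2].
pose G := [fset z in L]%fset.
have BG : (B `<=` G)%fset.
  apply/fsubsetP => -[x y] xyB; rewrite inE; apply/allpairsP.
  by exists (x, y); split => //; apply/imfsetP; exists (x, y).
have hG p : (p : {classic X * Y}) \notin G -> I (r p.1 p.2).
  by move=> pG; apply: hB; apply: contra pG => /(fsubsetP BG).
exists B1.
  move=> x xB; apply: ori_infsum => //; first exact: zero_convergent_fst.
  move=> y; apply: (hB (x, y)); apply: contra xB => xyB.
  by apply/imfsetP; exists (x, y).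
have hGr : \sum_(p <- G) r p.1 p.2 = \sum_(x <- B1) \sum_(y <- B2) r x y.
  rewrite (perm_big L) /=; first by rewrite big_allpairs.
  apply: uniq_perm; first exact: fset_uniq.
    by apply: allpairs_uniq; [exact: fset_uniq|exact: fset_uniq|case=> a b [c d] _ _ [-> ->]].
  by move=> p; rewrite inE.
set s := infsum _.
rewrite -(subrK (\sum_(p <- G) r p.1 p.2) (\sum_(x <- B1) _)) -addrA.
apply: oriD => //; last first.
  by rewrite -opprB; apply: oriN => //; apply: infsum_near.
rewrite hGr -sumrB; apply: ori_sum => // x _; apply: infsum_near => //.
  exact: zero_convergent_fst.
move=> y yB; apply: (hB (x, y)); apply: contra yB => xyB.
by apply/imfsetP; exists (x, y).
Qed.

End Double.

Lemma zero_convergent_swap X Y (r : X -> Y -> R) :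
  zero_convergent (fun p : X * Y => r p.1 p.2) ->
  zero_convergent (fun p : Y * X => r p.2 p.1).
Proof.
move=> /zero_convergentP zr; apply/zero_convergentP => I oI.
have [B hB] := zr I oI.
exists [fset ((p.2, p.1) : {classic Y * X}) | p : {classic X * Y} in B]%fset.
move=> [y x] xB; apply: (hB (x, y)); apply: contra xB => xyB.
by apply/imfsetP; exists (x, y).
Qed.

Lemma infsum_exchange X Y (r : X -> Y -> R) :
  zero_convergent (fun p : X * Y => r p.1 p.2) ->
  infsum (fun x => infsum (r x)) = infsum (fun y => infsum (r^~ y)).
Proof.
move=> zr; have zs := zero_convergent_swap zr.
rewrite infsum_pair // (infsum_pair zs).
apply: infsum_eq => // I oI; have [B hB] := (zero_convergentP _).1 zr I oI.
exists B => //.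
pose C := [fset ((p.2, p.1) : {classic Y * X}) | p : {classic X * Y} in B]%fset.
have -> : \sum_(x <- B) r x.1 x.2 = \sum_(x <- C) r x.2 x.1.
  by rewrite big_imfset //= => -[a b] [c d] _ _ [-> ->].
rewrite -opprB; apply: oriN => //; apply: infsum_near => // -[y x] xB.
apply: (hB (x, y)); apply: contra xB => xyB.
by apply/imfsetP; exists (x, y).
Qed.

End SumLemmas.

Section FormalSums.
Variable R : completeRightLinearType.
Implicit Types X Y : Type.

(* The set R[[X]] of formal sums \sum_x r x x. *)
Record formal_sum X := FormalSum {
  coef :> X -> R;
  coef_zero_convergent : zero_convergent coef
}.

Lemma formal_sum_eq X (s t : formal_sum X) : (forall x, s x = t x) -> s = t.
Proof.
case: s t => [s zs] [t zt] /= st.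
have e : s = t by exact: functional_extensionality_dep.
by case: _ / e zt => zt; congr FormalSum; exact: Prop_irrelevance.
Qed.

Lemma zero_convergent_bind X Y (r : formal_sum X) (g : X -> formal_sum Y) :
  zero_convergent (fun p : X * Y => r p.1 * g p.1 p.2).
Proof.
move=> I oI.
have [B hB] := (zero_convergentP _).1 (coef_zero_convergent r) I oI.
have /choice[C hC] : forall x, exists C : {fset {classic Y}},
    forall y, (y : {classic Y}) \notin C -> I (r x * g x y).
  move=> x; have /zero_convergentP := zero_convergentMl (r x) (coef_zero_convergent (g x)).
  exact.
apply: (@sub_finite_set _ _ (\bigcup_(x in [set` B]) [set (x, y) | y in [set` C x]])).
  move=> [x y] /= nI; exists x => /=.
    by apply/negPn/negP => /hB h; apply: nI; exact: oriM.
  by exists y => //; apply/negPn/negP => /hC.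
apply: bigcup_finite => [|x _]; first exact: finite_fset.
by apply: finite_image; exact: finite_fset.
Qed.

Lemma zero_convergent_map X Y (f : X -> Y) (r : formal_sum X) :
  zero_convergent (fun p : X * Y => if `[< f p.1 = p.2 >] then r p.1 else 0).
Proof.
move=> I oI; apply: (@sub_finite_set _ _ [set (x, f x) | x in [set x | ~ I (r x)]]).
  move=> [x y] /=; case: asboolP => [<-|_] nI; first by exists x.
  by case: nI; exact: ori0.
by apply: finite_image; exact: coef_zero_convergent.
Qed.

(* The coefficient of y sums the r x over the fiber of f at y. *)
Lemma map_zero_convergent X Y (f : X -> Y) (r : formal_sum X) :
  zero_convergent (fun y => infsum (fun x => if `[< f x = y >] then r x else 0)).
Proof.
exact: zero_convergent_infsum (zero_convergent_swap
  (r := fun x y => if `[< f x = y >] then r x else 0) (zero_convergent_map f r)).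
Qed.

Definition formal_sum_map X Y (f : X -> Y) (r : formal_sum X) : formal_sum Y :=
  FormalSum (map_zero_convergent f r).

Lemma unit_zero_convergent X (x : X) :
  zero_convergent (fun y => if `[< y = x >] then 1 else 0 : R).
Proof.
by apply: (@zero_convergent_single R _ x) => y yx; case: asboolP.
Qed.

Definition formal_sum_unit X (x : X) : formal_sum X :=
  FormalSum (unit_zero_convergent x).

Lemma join_zero_convergent X (r : formal_sum (formal_sum X)) :
  zero_convergent (fun x => infsum (fun s : formal_sum X => r s * s x)).
Proof.
exact: zero_convergent_infsum (zero_convergent_swap
  (r := fun (s : formal_sum X) x => r s * s x) (zero_convergent_bind r id)).
Qed.

(* Opening of parentheses. *)
Definition formal_sum_join X (r : formal_sum (formal_sum X)) : formal_sum X :=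
  FormalSum (join_zero_convergent r).

Lemma coef_formal_sum_map X Y (f : X -> Y) r y :
  formal_sum_map f r y = infsum (fun x => if `[< f x = y >] then r x else 0).
Proof. by []. Qed.

Lemma coef_formal_sum_join X (r : formal_sum (formal_sum X)) x :
  formal_sum_join r x = infsum (fun s => r s * s x).
Proof. by []. Qed.

Lemma coef_formal_sum_bind X Y (r : formal_sum X) (g : X -> formal_sum Y) y :
  formal_sum_join (formal_sum_map g r) y = infsum (fun x => r x * g x y).
Proof.
rewrite coef_formal_sum_join.
have zr := zero_convergent_map g r.
have zs := zero_convergentMr (fun p : X * formal_sum Y => p.2 y) zr.
rewrite (_ : (fun s => _) =
  fun s => infsum (fun x => (if `[< g x = s >] then r x else 0) * s y)); last first.
  apply/funext => s; rewrite coef_formal_sum_map infsumMr //.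
  exact: (zero_convergent_snd
    (r := fun x s => if `[< g x = s >] then r x else 0) zr s).
rewrite -(infsum_exchange
  (r := fun x s => (if `[< g x = s >] then r x else 0) * coef s y)) //.
congr infsum; apply/funext => x.
rewrite (@infsum_single _ _ (g x)); first by case: asboolP.
by move=> s sg; case: asboolP => [e|_]; [case: sg|rewrite mul0r].
Qed.

Lemma formal_sum_map_comp X Y Z (f : X -> Y) (g : Y -> Z) (r : formal_sum X) :
  formal_sum_map g (formal_sum_map f r) = formal_sum_map (g \o f) r.
Proof.
apply: formal_sum_eq => z; rewrite !coef_formal_sum_map.
have zr := zero_convergent_map f r.
pose d x y := if `[< g y = z >] then if `[< f x = y >] then r x else 0 else 0.
have zd : zero_convergent (fun p : X * Y => d p.1 p.2).
  move=> I oI; apply: sub_finite_set (zr I oI) => p /=; rewrite /d.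
  by case: ifP => // _ []; exact: ori0.
transitivity (infsum (fun y => infsum (d^~ y))).
  congr infsum; apply/funext => y; rewrite /d; case: ifP => // _.
  by rewrite infsum0.
rewrite -infsum_exchange //; congr infsum; apply/funext => x.
rewrite (@infsum_single _ _ (f x)); last first.
  move=> y yf; rewrite /d; case: ifP => // _; case: asboolP => // e.
  by case: yf.
by rewrite /d; case: (asboolP (f x = f x)).
Qed.
End FormalSums.

Section Contramodules.
Variable R : completeRightLinearType.

Record contramodule := Contramodule {
  contra_sort :> Type;
  contraaction : formal_sum R contra_sort -> contra_sort;
  contraactionA : forall t : formal_sum R (formal_sum R contra_sort),
    contraaction (formal_sum_map contraaction t) =
    contraaction (formal_sum_join t);
  contraaction_unit : forall c, contraaction (formal_sum_unit R c) = c
}.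

Record contra_hom (C D : contramodule) := ContraHom {
  contra_hom_fun :> C -> D;
  contra_homP : forall t, contra_hom_fun (contraaction t) =
                          contraaction (formal_sum_map contra_hom_fun t)
}.

Lemma contra_hom_eq (C D : contramodule) (f g : contra_hom C D) : f =1 g -> f = g.
Proof.
case: f g => [f hf] [g hg] /= /funext fg.
by case: _ / fg hg => hg; congr ContraHom; exact: Prop_irrelevance.
Qed.

Lemma formal_sum_joinA X (t : formal_sum R (formal_sum R (formal_sum R X))) :
  formal_sum_join (formal_sum_map (@formal_sum_join R X) t) =
  formal_sum_join (formal_sum_join t).
Proof.
apply: formal_sum_eq => x; rewrite coef_formal_sum_bind coef_formal_sum_join.
have zb := zero_convergent_bind t id.
have zs := zero_convergentMr
  (fun p : formal_sum R (formal_sum R X) * formal_sum R X => p.2 x) zb.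
transitivity (infsum (fun u => infsum (fun s : formal_sum R X => t u * u s * s x))).
  congr infsum; apply/funext => u; rewrite coef_formal_sum_join -infsumMl.
    by congr infsum; apply/funext => s; rewrite mulrA.
  by apply: zero_convergentMr; exact: coef_zero_convergent.
rewrite (infsum_exchange (r := fun (u : formal_sum R (formal_sum R X))
  (s : formal_sum R X) => t u * u s * s x)) //.
congr infsum; apply/funext => s; rewrite coef_formal_sum_join infsumMr //.
exact: (zero_convergent_snd (r := fun (u : formal_sum R (formal_sum R X))
  (s : formal_sum R X) => t u * u s) zb s).
Qed.

Lemma formal_sum_join_unit X (s : formal_sum R X) :
  formal_sum_join (formal_sum_unit R s) = s.
Proof.
apply: formal_sum_eq => x; rewrite coef_formal_sum_join.
rewrite (@infsum_single R _ s) /=; first by case: asboolP => // _; rewrite mul1r.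
by move=> u us; case: asboolP => // _; rewrite mul0r.
Qed.

Definition free_contramodule (X : Type) : contramodule :=
  Contramodule (@formal_sum_joinA X) (@formal_sum_join_unit X).

Definition is_coproduct (Z : Type) (C : Z -> contramodule) (D : contramodule)
    (inj : forall z, contra_hom (C z) D) :=
  forall (E : contramodule) (f : forall z, contra_hom (C z) E),
    exists! g : contra_hom D E, forall z c, g (inj z c) = f z c.

Section AdditiveStructure.
Variable X : Type.
Implicit Types s t : formal_sum R X.

Lemma formal_sum0_zero_convergent : zero_convergent (fun _ : X => 0 : R).
Proof. by apply/zero_convergentP => I oI; exists fset0 => x _; exact: ori0. Qed.

Definition formal_sum0 : formal_sum R X := FormalSum formal_sum0_zero_convergent.

Definition formal_sumD s t : formal_sum R X := FormalSum
  (zero_convergentD (coef_zero_convergent s) (coef_zero_convergent t)).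

Definition formal_sumN s : formal_sum R X := FormalSum
  (zero_convergentN (coef_zero_convergent s)).

Lemma formal_sum_map0 Y (f : X -> Y) : formal_sum_map f formal_sum0 =1 (fun=> 0).
Proof.
move=> y /=; rewrite -[RHS](@infsum0 R X); congr infsum.
by apply/funext => x; case: ifP.
Qed.

Lemma zero_convergent_fiber Y (f : X -> Y) s y :
  zero_convergent (fun x => if `[< f x = y >] then s x else 0).
Proof.
exact: (zero_convergent_snd (r := fun x y => if `[< f x = y >] then s x else 0)
  (zero_convergent_map f s) y).
Qed.

Lemma formal_sum_mapD Y (f : X -> Y) s t y :
  formal_sum_map f (formal_sumD s t) y = formal_sum_map f s y + formal_sum_map f t y.
Proof.
rewrite /= -infsumD; [|exact: zero_convergent_fiber..].
by congr infsum; apply/funext => x; case: ifP => //; rewrite addr0.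
Qed.

Lemma formal_sum_mapN Y (f : X -> Y) s y :
  formal_sum_map f (formal_sumN s) y = - formal_sum_map f s y.
Proof.
rewrite /= -infsumN; last exact: zero_convergent_fiber.
by congr infsum; apply/funext => x; case: ifP => //; rewrite oppr0.
Qed.

Lemma formal_sum_map_unit Y (f : X -> Y) (x : X) :
  formal_sum_map f (formal_sum_unit R x) = formal_sum_unit R (f x).
Proof.
apply: formal_sum_eq => y /=; rewrite (@infsum_single R _ x).
  by rewrite (asboolT (erefl x)) (asbool_equiv_eq (Q := y = f x)).
by move=> x' xx; case: ifP => // _; case: asboolP.
Qed.
End AdditiveStructure.

Section Addition.
Variable C : contramodule.
Implicit Types x y : C.
Implicit Types s t : formal_sum R C.
Local Notation pi := (@contraaction C).
Local Notation eps := (@formal_sum_unit R C).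

(* The addition of a contramodule is x + y := pi (1 x + 1 y). *)
Definition contra0 : C := pi (formal_sum0 C).
Definition contraD x y : C := pi (formal_sumD (eps x) (eps y)).
Definition contraN x : C := pi (formal_sumN (eps x)).

Lemma contraaction_bind X (t : formal_sum R X) (h : X -> formal_sum R C) :
  pi (formal_sum_map (fun i => pi (h i)) t) =
  pi (formal_sum_join (formal_sum_map h t)).
Proof. by rewrite -contraactionA formal_sum_map_comp. Qed.

Lemma contraactionD s t : contraD (pi s) (pi t) = pi (formal_sumD s t).
Proof.
pose e := @formal_sum_unit R (formal_sum R C).
rewrite /contraD.
have -> : formal_sumD (eps (pi s)) (eps (pi t)) =
          formal_sum_map pi (formal_sumD (e s) (e t)).
  by apply: formal_sum_eq => c; rewrite formal_sum_mapD !formal_sum_map_unit.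
rewrite contraactionA; congr contraaction; apply: formal_sum_eq => c.
rewrite coef_formal_sum_join -[in RHS](formal_sum_join_unit s)
  -[in RHS](formal_sum_join_unit t) /= -infsumD.
- by congr infsum; apply/funext => u; rewrite mulrDl.
- by apply: zero_convergentMr; exact: unit_zero_convergent.
- by apply: zero_convergentMr; exact: unit_zero_convergent.
Qed.

Lemma contraactionN s : contraN (pi s) = pi (formal_sumN s).
Proof.
pose e := @formal_sum_unit R (formal_sum R C).
rewrite /contraN.
have -> : formal_sumN (eps (pi s)) = formal_sum_map pi (formal_sumN (e s)).
  by apply: formal_sum_eq => c; rewrite formal_sum_mapN !formal_sum_map_unit.
rewrite contraactionA; congr contraaction; apply: formal_sum_eq => c.
rewrite coef_formal_sum_join -[in RHS](formal_sum_join_unit s) /= -infsumN.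
- by congr infsum; apply/funext => u; rewrite mulNr.
- by apply: zero_convergentMr; exact: unit_zero_convergent.
Qed.

Lemma contraDA : associative contraD.
Proof.
move=> x y z; rewrite -(contraaction_unit x) -(contraaction_unit y)
  -(contraaction_unit z) !contraactionD.
by congr contraaction; apply: formal_sum_eq => c /=; rewrite addrA.
Qed.

Lemma contraDC : commutative contraD.
Proof.
move=> x y; rewrite -(contraaction_unit x) -(contraaction_unit y) !contraactionD.
by congr contraaction; apply: formal_sum_eq => c /=; rewrite addrC.
Qed.

Lemma contra0D : left_id contra0 contraD.
Proof.
move=> x; rewrite -(contraaction_unit x) contraactionD.
by congr contraaction; apply: formal_sum_eq => c /=; rewrite add0r.
Qed.

Lemma contraND : left_inverse contra0 contraN contraD.
Proof.
move=> x; rewrite -(contraaction_unit x) contraactionN contraactionD.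
by congr contraaction; apply: formal_sum_eq => c /=; rewrite addNr.
Qed.
End Addition.

Section HomAddition.
Variables C D : contramodule.
Implicit Types (f g : contra_hom C D) (t : formal_sum R C).

Lemma contra_hom0 f : f (contra0 C) = contra0 D.
Proof.
rewrite contra_homP; congr contraaction.
by apply: formal_sum_eq => y; rewrite formal_sum_map0.
Qed.

Lemma contra_homD f x y : f (contraD x y) = contraD (f x) (f y).
Proof.
rewrite contra_homP; congr contraaction.
by apply: formal_sum_eq => z; rewrite formal_sum_mapD !formal_sum_map_unit.
Qed.

Lemma contra_hom_zeroP t : contra0 D = contraaction (formal_sum_map (fun _ : C => contra0 D) t).
Proof.
rewrite contraaction_bind; congr contraaction; apply: formal_sum_eq => y.
rewrite coef_formal_sum_bind -[LHS](@infsum0 R C); congr infsum.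
by apply/funext => x; rewrite /= mulr0.
Qed.

Lemma coef_formal_sum_map_unit f t y :
  formal_sum_map f t y = infsum (fun x => t x * formal_sum_unit R (f x) y).
Proof.
congr infsum; apply/funext => x /=.
rewrite (@asbool_equiv_eq (y = f x) (f x = y)) //.
by case: asboolP => _; rewrite ?mulr1 ?mulr0.
Qed.

Lemma zero_convergent_map_unit f t y :
  zero_convergent (fun x => t x * formal_sum_unit R (f x) y).
Proof. by apply: zero_convergentMr; exact: coef_zero_convergent. Qed.

Lemma contra_hom_addP f g t : contraD (f (contraaction t)) (g (contraaction t)) =
  contraaction (formal_sum_map (fun x => contraD (f x) (g x)) t).
Proof.
rewrite !contra_homP contraactionD contraaction_bind.
congr contraaction; apply: formal_sum_eq => y.
rewrite coef_formal_sum_bind [LHS]/=.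
rewrite -[infsum _]/(formal_sum_map f t y) -[X in _ + X]/(formal_sum_map g t y).
rewrite !coef_formal_sum_map_unit -infsumD; [|exact: zero_convergent_map_unit..].
by congr infsum; apply/funext => x; rewrite -mulrDr.
Qed.

Lemma contra_hom_oppP f t : contraN (f (contraaction t)) =
  contraaction (formal_sum_map (fun x => contraN (f x)) t).
Proof.
rewrite !contra_homP contraactionN contraaction_bind.
congr contraaction; apply: formal_sum_eq => y.
rewrite coef_formal_sum_bind [LHS]/=.
rewrite -[infsum _]/(formal_sum_map f t y).
rewrite !coef_formal_sum_map_unit -infsumN; last exact: zero_convergent_map_unit.
by congr infsum; apply/funext => x; rewrite -mulrN.
Qed.
End HomAddition.

Lemma contra_idP (C : contramodule) (t : formal_sum R C) :
  contraaction t = contraaction (formal_sum_map id t).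
Proof.
congr contraaction; apply: formal_sum_eq => x /=; rewrite (@infsum_single R _ x).
  by rewrite asboolT.
by move=> y yx; case: asboolP.
Qed.

Lemma contra_compP (C D E : contramodule) (g : contra_hom D E) (f : contra_hom C D) t :
  g (f (contraaction t)) = contraaction (formal_sum_map (fun x => g (f x)) t).
Proof. by rewrite !contra_homP formal_sum_map_comp. Qed.

Section EndomorphismRing.
Variable C : contramodule.

Definition contra_end : Type := contra_hom C C.

HB.instance Definition _ := gen_eqMixin contra_end.
HB.instance Definition _ := gen_choiceMixin contra_end.

Definition contra_end0 : contra_end := ContraHom (@contra_hom_zeroP C C).
Definition contra_endD (f g : contra_end) : contra_end := ContraHom (contra_hom_addP f g).
Definition contra_endN (f : contra_end) : contra_end := ContraHom (contra_hom_oppP f).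
Definition contra_end1 : contra_end := @ContraHom C C id (@contra_idP C).
Definition contra_endM (f g : contra_end) : contra_end := ContraHom (contra_compP f g).

Fact contra_endDA : associative contra_endD.
Proof. by move=> f g h; apply: contra_hom_eq => x /=; rewrite contraDA. Qed.
Fact contra_endDC : commutative contra_endD.
Proof. by move=> f g; apply: contra_hom_eq => x /=; rewrite contraDC. Qed.
Fact contra_end0D : left_id contra_end0 contra_endD.
Proof. by move=> f; apply: contra_hom_eq => x /=; rewrite contra0D. Qed.
Fact contra_endND : left_inverse contra_end0 contra_endN contra_endD.
Proof. by move=> f; apply: contra_hom_eq => x /=; rewrite contraND. Qed.

HB.instance Definition _ := GRing.isZmodule.Build contra_end
  contra_endDA contra_endDC contra_end0D contra_endND.

Fact contra_endMA : associative contra_endM.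
Proof. by move=> f g h; exact: contra_hom_eq. Qed.
Fact contra_end1M : left_id contra_end1 contra_endM.
Proof. by move=> f; exact: contra_hom_eq. Qed.
Fact contra_endM1 : right_id contra_end1 contra_endM.
Proof. by move=> f; exact: contra_hom_eq. Qed.
Fact contra_endMDl : left_distributive contra_endM contra_endD.
Proof. by move=> f g h; exact: contra_hom_eq. Qed.
Fact contra_endMDr : right_distributive contra_endM contra_endD.
Proof. by move=> f g h; apply: contra_hom_eq => x /=; exact: contra_homD. Qed.

HB.instance Definition _ := GRing.Zmodule_isPzRing.Build contra_end
  contra_endMA contra_end1M contra_endM1 contra_endMDl contra_endMDr.

End EndomorphismRing.
End Contramodules.

Local Obligation Tactic := idtac.

Section RightRegular.
Variable R : completeRightLinearType.

Lemma right_regular_base (U : set R) : nbhs (0 : R) U ->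
  exists2 N : set R, open N /\ submodule *%R N & N `<=` U.
Proof. by move=> /open_right_ideal_base. Qed.

Definition right_regular : topRightModule R :=
  @TopRightModule R R *%R (fun m a b => esym (mulrA m a b)) (@mulr1 R)
    (@mulrDl R) (@mulrDr R) (@ring_mul_continuous R) right_regular_base
    (@ring_complete_separated R).

End RightRegular.

Section ContinuousEndomorphisms.
Variables (R : topPzRingType) (M : topRightModule R).

Record continuous_end := ContinuousEnd {
  continuous_end_fun :> M -> M;
  continuous_endD : forall m n, continuous_end_fun (m + n) =
                                continuous_end_fun m + continuous_end_fun n;
  continuous_end_ract : forall m (a : R), continuous_end_fun (ract m a) =
                                          ract (continuous_end_fun m) a;
  continuous_end_continuous : continuous continuous_end_fun
}.
Implicit Types f g h : continuous_end.

Lemma continuous_end_eq f g : f =1 g -> f = g.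
Proof.
case: f g => [f fD fR fc] [g gD gR gc] /= /funext fg.
by case: _ / fg gD gR gc => *; congr ContinuousEnd; exact: Prop_irrelevance.
Qed.

HB.instance Definition _ := gen_eqMixin continuous_end.
HB.instance Definition _ := gen_choiceMixin continuous_end.

Lemma ract0 (a : R) : ract (0 : M) a = 0.
Proof. by apply: (addrI (ract (0 : M) a)); rewrite -ractDl !addr0. Qed.

Lemma ractN (m : M) (a : R) : ract (- m) a = - ract m a.
Proof. by apply: (addrI (ract m a)); rewrite -ractDl !subrr ract0. Qed.

Program Definition continuous_end0 := @ContinuousEnd (fun=> 0) _ _ _.
Next Obligation. by move=> m n /=; rewrite addr0. Qed.
Next Obligation. by move=> m a /=; rewrite ract0. Qed.
Next Obligation. by move=> x; exact: cvg_cst. Qed.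

Program Definition continuous_end_add f g := @ContinuousEnd (fun m => f m + g m) _ _ _.
Next Obligation. by move=> f g m n /=; rewrite !continuous_endD addrACA. Qed.
Next Obligation. by move=> f g m a /=; rewrite !continuous_end_ract ractDl. Qed.
Next Obligation.
move=> f g x.
apply: (@continuous_comp _ _ _ (fun m => (f m, g m)) (fun x : M * M => x.1 + x.2)).
  by apply: cvg_pair; exact: continuous_end_continuous.
exact: add_continuous.
Qed.

Program Definition continuous_end_opp f := @ContinuousEnd (fun m => - f m) _ _ _.
Next Obligation. by move=> f m n /=; rewrite continuous_endD opprD. Qed.
Next Obligation. by move=> f m a /=; rewrite continuous_end_ract ractN. Qed.
Next Obligation.
move=> f x; apply: (@continuous_comp _ _ _ f -%R); first exact: continuous_end_continuous.
exact: opp_continuous.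
Qed.

Program Definition continuous_end1 := @ContinuousEnd id _ _ _.
Next Obligation. by []. Qed.
Next Obligation. by []. Qed.
Next Obligation. by move=> x; exact: cvg_id. Qed.

Program Definition continuous_end_mul f g := @ContinuousEnd (fun m => f (g m)) _ _ _.
Next Obligation. by move=> f g m n /=; rewrite !continuous_endD. Qed.
Next Obligation. by move=> f g m a /=; rewrite !continuous_end_ract. Qed.
Next Obligation.
by move=> f g x; apply: continuous_comp; exact: continuous_end_continuous.
Qed.

Fact continuous_end_addA : associative continuous_end_add.
Proof. by move=> f g h; apply: continuous_end_eq => x /=; rewrite addrA. Qed.
Fact continuous_end_addC : commutative continuous_end_add.
Proof. by move=> f g; apply: continuous_end_eq => x /=; rewrite addrC. Qed.
Fact continuous_end_add0 : left_id continuous_end0 continuous_end_add.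
Proof. by move=> f; apply: continuous_end_eq => x /=; rewrite add0r. Qed.
Fact continuous_end_addN : left_inverse continuous_end0 continuous_end_opp continuous_end_add.
Proof. by move=> f; apply: continuous_end_eq => x /=; rewrite addNr. Qed.

HB.instance Definition _ := GRing.isZmodule.Build continuous_end
  continuous_end_addA continuous_end_addC continuous_end_add0 continuous_end_addN.

Fact continuous_end_mulA : associative continuous_end_mul.
Proof. by move=> f g h; exact: continuous_end_eq. Qed.
Fact continuous_end_mul1l : left_id continuous_end1 continuous_end_mul.
Proof. by move=> f; exact: continuous_end_eq. Qed.
Fact continuous_end_mul1r : right_id continuous_end1 continuous_end_mul.
Proof. by move=> f; exact: continuous_end_eq. Qed.
Fact continuous_end_mulDl : left_distributive continuous_end_mul continuous_end_add.
Proof. by move=> f g h; exact: continuous_end_eq. Qed.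
Fact continuous_end_mulDr : right_distributive continuous_end_mul continuous_end_add.
Proof. by move=> f g h; apply: continuous_end_eq => x /=; exact: continuous_endD. Qed.

HB.instance Definition _ := GRing.Zmodule_isPzRing.Build continuous_end
  continuous_end_mulA continuous_end_mul1l continuous_end_mul1r
  continuous_end_mulDl continuous_end_mulDr.

End ContinuousEndomorphisms.

(* N is the direct product of the M z with projections p z: the R-linear map
   n |-> (p z n)_z is a homeomorphism onto the product of the M z. *)
Definition is_direct_product (R : topPzRingType) (Z : Type)
    (M : Z -> topRightModule R) (N : topRightModule R) (p : forall z, N -> M z) :=
  [/\ forall z m n, p z (m + n) = p z m + p z n,
      forall z m (a : R), p z (ract m a) = ract (p z m) a &
      let F : N -> prod_topology (fun z => M z : topologicalType) :=
        fun n z => p z n in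
      exists G, [/\ cancel F G, cancel G F, continuous F & continuous G]].

(* The ring e R e, with unit e, of an idempotent e. *)
Section Corner.
Variables (R : pzRingType) (e : R) (ee : e * e = e).

Definition corner (_ : e * e = e) : Type := {x : R | exists r, x = e * r * e}.
Local Notation eRe := (corner ee).

HB.instance Definition _ := gen_eqMixin eRe.
HB.instance Definition _ := gen_choiceMixin eRe.

Lemma corner_eq (x y : eRe) : sval x = sval y -> x = y.
Proof. by case: x y => [x px] [y py] /= xy; exact: eq_exist. Qed.

Lemma cornerl (x : eRe) : e * sval x = sval x.
Proof. by case: x => x /= [r ->]; rewrite !mulrA ee. Qed.

Lemma cornerr (x : eRe) : sval x * e = sval x.
Proof. by case: x => x /= [r ->]; rewrite -!mulrA ee. Qed.

Lemma in_corner (x : R) : e * x = x -> x * e = x -> exists r, x = e * r * e.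
Proof. by move=> xl xr; exists x; rewrite xl xr. Qed.

Program Definition corner0 : eRe := exist _ 0 _.
Next Obligation. by apply: in_corner; rewrite ?mulr0 ?mul0r. Qed.
Program Definition cornerD (x y : eRe) : eRe := exist _ (sval x + sval y) _.
Next Obligation.
by move=> x y; apply: in_corner; rewrite ?mulrDr ?mulrDl ?cornerl ?cornerr.
Qed.
Program Definition cornerN (x : eRe) : eRe := exist _ (- sval x) _.
Next Obligation. by move=> x; apply: in_corner; rewrite ?mulrN ?mulNr ?cornerl ?cornerr. Qed.
Program Definition corner1 : eRe := exist _ e _.
Next Obligation. by apply: in_corner. Qed.
Program Definition cornerM (x y : eRe) : eRe := exist _ (sval x * sval y) _.
Next Obligation.
by move=> x y; apply: in_corner; rewrite ?mulrA ?cornerl // -mulrA cornerr.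
Qed.

Fact cornerDA : associative cornerD.
Proof. by move=> x y z; apply: corner_eq; rewrite /= addrA. Qed.
Fact cornerDC : commutative cornerD.
Proof. by move=> x y; apply: corner_eq; rewrite /= addrC. Qed.
Fact corner0D : left_id corner0 cornerD.
Proof. by move=> x; apply: corner_eq; rewrite /= add0r. Qed.
Fact cornerND : left_inverse corner0 cornerN cornerD.
Proof. by move=> x; apply: corner_eq; rewrite /= addNr. Qed.

HB.instance Definition _ := GRing.isZmodule.Build eRe
  cornerDA cornerDC corner0D cornerND.

Fact cornerMA : associative cornerM.
Proof. by move=> x y z; apply: corner_eq; rewrite /= mulrA. Qed.
Fact corner1M : left_id corner1 cornerM.
Proof. by move=> x; apply: corner_eq; exact: cornerl. Qed.
Fact cornerM1 : right_id corner1 cornerM.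
Proof. by move=> x; apply: corner_eq; exact: cornerr. Qed.
Fact cornerMDl : left_distributive cornerM cornerD.
Proof. by move=> x y z; apply: corner_eq; rewrite /= mulrDl. Qed.
Fact cornerMDr : right_distributive cornerM cornerD.
Proof. by move=> x y z; apply: corner_eq; rewrite /= mulrDr. Qed.

HB.instance Definition _ := GRing.Zmodule_isPzRing.Build eRe
  cornerMA corner1M cornerM1 cornerMDl cornerMDr.

End Corner.

(* Main.v *)
Require Import Defs.
From HB Require Import structures.
From mathcomp Require Import all_boot all_algebra finmap all_classical topology tvs.
From mathcomp.analysis.showcase Require summability.

Set Implicit Arguments.
Unset Strict Implicit.
Unset Printing Implicit Defensive.

Import GRing.Theory.
Local Open Scope classical_set_scope.
Local Open Scope ring_scope.

(** Both kinds of decomposition are encoded by the same data, a zero-convergent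
    family of orthogonal idempotents [e z] with sum [1], and the summand at [z]
    has endomorphism ring [e z R e z], up to reversal of products.

    On the contramodule side, the endomorphisms of the free contramodule with
    one generator are the right multiplications by elements of [R]
    ([coef_contra_hom_free1]), so a direct summand with inclusion [i] and
    projection [p] corresponds to the idempotent [e = i (p 1)], and its
    endomorphism ring is opposite to [e R e] ([local_contra_end]).  A coproduct
    has projections, obtained from its universal property, hence yields
    orthogonal idempotents.  The point that needs an idea is that these converge
    to zero and sum to [1].  There is a homomorphism from [R] to the free
    contramodule on [Z] that sends [x] in the summand at [z] to [x z].  The image
    of [1] is a formal sum, so its coefficients converge to zero; composing with
    the coordinate maps shows that these coefficients are the [e z], and
    composing with the map that sends every generator to [1] shows that their
    sum is [1] ([coproduct_elt_sum]).  Conversely, homomorphisms [f z] from the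
    [R e z] to a contramodule extend uniquely to [R]: the value at [1] must be
    the contraaction of the formal sum of the [e z] placed at the [f z (e z)]
    ([left_summand_coproduct]).

    On the module side, continuous endomorphisms are left multiplications, and
    the endomorphism ring of a direct summand is isomorphic to [e R e]
    ([local_continuous_end]).  Given idempotents, the subspaces [e z R] are
    complete, and the inverse of the map from [R] to their product is summation:
    a family [m z] in the [e z R] is zero-convergent since [m z = e z m z]
    ([idempotents_direct_product]).  Conversely, in a product decomposition the
    partial sums of the [e z] correspond to families that agree with the image of
    [1] at more and more coordinates, so they converge to it in the product
    topology, and the inverse homeomorphism carries this convergence to [R]
    ([product_elt_has_sum]); a summable family converges to zero. *)

(** * Locality of rings *)

Lemma local_ring_transport (A B : pzRingType) (f : A -> B) (g : B -> A) :
  cancel f g -> cancel g f -> f 1 = 1 ->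
  (forall x y, f (x - y) = f x - f y) ->
  (forall x y, f (x * y) = f x * f y) ->
  local_ring A -> local_ring B.
Proof.
move=> fK gK f1 fB fM [nz [n0 nB]].
have f0 : f 0 = 0 by rewrite -[in LHS](subrr 0) fB subrr.
have inv x : invertible (f x) <-> invertible x.
  split=> -[y [xy yx]]; last by exists (f y); rewrite -!fM xy yx.
  by exists (g y); split; apply: (can_inj fK); rewrite fM gK f1.
split; first by rewrite -f1 -f0 => /(can_inj fK).
split=> [|x y]; first by rewrite /= -f0 inv.
by rewrite /= -[x]gK -[y]gK -fB !inv; exact: nB.
Qed.

Lemma local_ring_iso (A B : pzRingType) (f : A -> B) (g : B -> A) :
  cancel f g -> cancel g f -> f 1 = 1 ->
  (forall x y, f (x - y) = f x - f y) ->
  (forall x y, f (x * y) = f x * f y) ->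
  local_ring A <-> local_ring B.
Proof.
move=> fK gK f1 fB fM; split; first exact: local_ring_transport fM.
apply: (local_ring_transport gK fK) => [|x y|x y]; apply: (can_inj fK).
- by rewrite gK f1.
- by rewrite gK fB !gK.
- by rewrite gK fM !gK.
Qed.

(** Invertibility is a two-sided notion, so locality ignores the order of
    products; this serves the contramodule side, where composition is reversed. *)
Lemma local_ring_converse (A : pzRingType) : local_ring A^c <-> local_ring A.
Proof.
have inv (x : A) : invertible (x : A^c) <-> invertible x.
  by split=> -[y [xy yx]]; exists y.
split=> -[nz [n0 nB]]; split=> //; split=> [|x y] /=.
- by rewrite -inv.
- by rewrite -!inv; exact: nB.
- by rewrite inv.
- by rewrite !inv; exact: nB.
Qed.

(** * Homomorphisms from free contramodules *)

Section FreeContramodules.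
Variable R : completeRightLinearType.

(** The two sides are the two orders of summation of one double sum.  Naturality
    makes the extension of a map [X -> E] to the free contramodule on [X] a
    homomorphism. *)
Lemma formal_sum_join_natural X Y (f : X -> Y) (t : formal_sum R (formal_sum R X)) :
  formal_sum_map f (formal_sum_join t) =
  formal_sum_join (formal_sum_map (formal_sum_map f) t).
Proof.
apply: formal_sum_eq => y; rewrite coef_formal_sum_bind.
pose d x : R := if `[< f x = y >] then 1 else 0.
have mapE s : formal_sum_map f s y = infsum (fun x => s x * d x).
  congr infsum; apply/funext => x; rewrite /d.
  by case: asboolP; rewrite ?mulr1 ?mulr0.
have zb := zero_convergent_bind t id.
have zd := zero_convergentMr (fun p : formal_sum R X * X => d p.2) zb.
rewrite mapE.
transitivity (infsum (fun x => infsum (fun u : formal_sum R X => t u * u x * d x))).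
  congr infsum; apply/funext => x; rewrite coef_formal_sum_join infsumMr //.
  exact: (zero_convergent_snd (r := fun (u : formal_sum R X) x => t u * u x) zb).
rewrite -(infsum_exchange
  (r := fun (u : formal_sum R X) x => t u * u x * d x)) //.
congr infsum; apply/funext => u; rewrite mapE -infsumMl; last first.
  by apply: zero_convergentMr; exact: coef_zero_convergent.
by congr infsum; apply/funext => x; rewrite mulrA.
Qed.

Lemma free_ext_homP X (E : contramodule R) (a : X -> E)
    (t : formal_sum R (free_contramodule R X)) :
  contraaction (formal_sum_map a (contraaction t)) =
  contraaction (formal_sum_map (fun s : free_contramodule R X =>
    contraaction (formal_sum_map a s)) t).
Proof. by rewrite contraaction_bind -formal_sum_join_natural. Qed.

Definition free_ext X (E : contramodule R) (a : X -> E) :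
  contra_hom (free_contramodule R X) E := ContraHom (free_ext_homP a).

Lemma free_ext_unit X (E : contramodule R) (a : X -> E) x :
  free_ext a (formal_sum_unit R x) = a x.
Proof. by rewrite /= formal_sum_map_unit contraaction_unit. Qed.

Lemma formal_sum_join_map_unit X (s : formal_sum R X) :
  formal_sum_join (formal_sum_map (@formal_sum_unit R X) s) = s.
Proof.
apply: formal_sum_eq => x; rewrite coef_formal_sum_bind (@infsum_single R _ x) /=.
  by rewrite asboolT // mulr1.
by move=> y yx; case: asboolP => [e|_]; [case: yx|rewrite mulr0].
Qed.

(** Every formal sum is the contraaction of the formal sum of its own generators,
    so the values on generators determine a homomorphism. *)
Lemma contra_hom_free X (E : contramodule R) (f : contra_hom (free_contramodule R X) E) s :
  f s = free_ext (fun x => f (formal_sum_unit R x)) s.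
Proof.
rewrite -[in LHS](formal_sum_join_map_unit s).
by rewrite (contra_homP f (formal_sum_map (@formal_sum_unit R X) s)) formal_sum_map_comp.
Qed.

Lemma free_ext_comp X (E F : contramodule R) (h : contra_hom E F) (a : X -> E) s :
  h (free_ext a s) = free_ext (fun x => h (a x)) s.
Proof. by rewrite /= contra_homP formal_sum_map_comp. Qed.

Lemma coef_free_ext X Y (a : X -> free_contramodule R Y) (t : free_contramodule R X) y :
  coef (free_ext a t) y = infsum (fun x => coef t x * coef (a x) y).
Proof. exact: coef_formal_sum_bind. Qed.

Definition free1 := free_contramodule R unit.

(** The ring [R] is identified with the formal sums on one generator. *)
Definition free1_elt (r : R) : free1 :=
  FormalSum (@zero_convergent_single R _ tt (fun=> r)
    (fun x (h : x <> tt) => match h (match x with tt => erefl end) with end)).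

Lemma free1_eq (s t : free1) : coef s tt = coef t tt -> s = t.
Proof. by move=> st; apply: formal_sum_eq => -[]. Qed.

Lemma free1_eltK (s : free1) : free1_elt (coef s tt) = s.
Proof. exact: free1_eq. Qed.

Lemma formal_sum_unit_tt : formal_sum_unit R tt = free1_elt 1.
Proof. by apply: free1_eq => /=; rewrite asboolT. Qed.

(** A homomorphism from [R] commutes with the left action of [R], so it is
    determined by its value at [1]; its coordinates are right multiplications. *)
Lemma coef_contra_hom_free1 X (f : contra_hom free1 (free_contramodule R X)) r x :
  coef (f (free1_elt r)) x = r * coef (f (free1_elt 1)) x.
Proof.
rewrite contra_hom_free coef_free_ext (@infsum_single R _ tt) => [|[]] //.
by rewrite formal_sum_unit_tt.
Qed.

Lemma free_ext_const (E : contramodule R) (f : contra_hom free1 E) s :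
  free_ext (fun=> f (free1_elt 1)) s = f s.
Proof.
rewrite [RHS]contra_hom_free; congr (free_ext _ s).
by apply/funext => -[]; rewrite formal_sum_unit_tt.
Qed.

Lemma contra_hom_free1_eq (E : contramodule R) (f g : contra_hom free1 E) :
  f (free1_elt 1) = g (free1_elt 1) -> f =1 g.
Proof.
by move=> fg s; rewrite -(free_ext_const f) -(free_ext_const g) fg.
Qed.

Lemma coef_contraD_free X (s t : free_contramodule R X) x :
  coef (contraD s t) x = coef s x + coef t x.
Proof.
rewrite -[in RHS](formal_sum_join_unit s) -[in RHS](formal_sum_join_unit t).
rewrite [in RHS]coef_formal_sum_join [in RHS]coef_formal_sum_join -infsumD.
- by congr infsum; apply/funext => u; rewrite mulrDl.
- by apply: zero_convergentMr; exact: unit_zero_convergent.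
- by apply: zero_convergentMr; exact: unit_zero_convergent.
Qed.
End FreeContramodules.

Definition contra_comp R (C D E : contramodule R) (g : contra_hom D E)
  (f : contra_hom C D) : contra_hom C E := ContraHom (contra_compP g f).

(** * Direct summands of the free contramodule with one generator *)

Section ContraRetract.
Variables (R : completeRightLinearType) (C : contramodule R).
Variables (i : contra_hom C (free1 R)) (p : contra_hom (free1 R) C).
Hypothesis ip : forall c, p (i c) = c.

(** The endomorphism [i \o p] of [R] is the right multiplication by this element. *)
Definition retract_elt := coef (i (p (free1_elt 1))) tt.
Local Notation e := retract_elt.

Lemma coef_retract s : coef (i (p s)) tt = coef s tt * e.
Proof. by rewrite -[s in LHS]free1_eltK (coef_contra_hom_free1 (contra_comp i p)). Qed.

Lemma retract_elt_idem : e * e = e.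
Proof. by rewrite -coef_retract ip. Qed.

Variable ee : e * e = e.

Definition right_mul (r : R) : contra_hom (free1 R) (free1 R) :=
  free_ext (fun=> free1_elt r).

Lemma coef_right_mul r s : coef (right_mul r s) tt = coef s tt * r.
Proof.
by rewrite coef_free_ext (@infsum_single R _ tt) // => -[].
Qed.

Definition retract_end (x : corner ee) : (contra_end C)^c :=
  contra_comp p (contra_comp (right_mul (sval x)) i).

Definition retract_coef (f : (contra_end C)^c) : R :=
  coef (i ((f : contra_end C) (p (free1_elt 1)))) tt.

Lemma retract_coef_corner f : exists r, retract_coef f = e * r * e.
Proof.
apply: in_corner => //.
  rewrite -(coef_contra_hom_free1 (contra_comp i (contra_comp f p))) /=.
  rewrite (_ : free1_elt e = i (p (free1_elt 1))) ?ip //.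
  exact: free1_eq.
by rewrite -coef_retract ip.
Qed.

Definition end_retract (f : (contra_end C)^c) : corner ee :=
  exist _ (retract_coef f) (retract_coef_corner f).

Lemma retract_endK : cancel retract_end end_retract.
Proof.
move=> x; apply: corner_eq.
by rewrite /= /retract_coef /= coef_retract coef_right_mul coef_retract mul1r cornerl cornerr.
Qed.

(** An endomorphism [f] is recovered from [i \o f \o p], an endomorphism of [R],
    hence from the value of the latter at [1]. *)
Lemma end_retractK : cancel end_retract retract_end.
Proof.
move=> f; apply: contra_hom_eq => c /=.
rewrite -[in RHS](ip c) -[in RHS](ip (f _)); congr (p _); apply: free1_eq.
rewrite coef_right_mul /= /retract_coef -[in RHS](free1_eltK (i c)).
by rewrite [RHS](coef_contra_hom_free1 (contra_comp i (contra_comp f p))).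
Qed.

(** Endomorphisms of [R e] are right multiplications by elements of [e R e]:
    composing them multiplies these elements in the reverse order. *)
Lemma local_contra_end_retract : local_ring (contra_end C) <-> local_ring (corner ee).
Proof.
rewrite -local_ring_converse; apply: iff_sym.
apply: (local_ring_iso retract_endK end_retractK).
- apply: (can_inj end_retractK); rewrite retract_endK; exact: corner_eq.
- move=> x y; suff E u v : retract_end (u + v) = retract_end u + retract_end v.
    have -> : retract_end x = retract_end (x - y) + retract_end y by rewrite -E subrK.
    by rewrite addrK.
  apply: contra_hom_eq => d; rewrite -[LHS]/(p (right_mul (sval u + sval v) (i d))).
  rewrite -[RHS]/(contraD (p (right_mul (sval u) (i d))) (p (right_mul (sval v) (i d)))).
  rewrite -contra_homD; congr (p _); apply: free1_eq.
  by rewrite coef_contraD_free !coef_right_mul mulrDr.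
- move=> x y; apply: contra_hom_eq => c.
  rewrite -[LHS]/(p (right_mul (sval x * sval y) (i c))).
  rewrite -[RHS]/(p (right_mul (sval y) (i (p (right_mul (sval x) (i c)))))).
  congr (p _); apply: free1_eq.
  by rewrite !coef_right_mul coef_retract coef_right_mul -!mulrA cornerl.
Qed.
End ContraRetract.

(** The type of the corner ring depends on the idempotent, so an idempotent that is
    only provably equal to [retract_elt i p] has to be substituted before locality
    is compared. *)
Lemma local_contra_end (R : completeRightLinearType) (C : contramodule R)
    (i : contra_hom C (free1 R)) (p : contra_hom (free1 R) C) (e : R) (ee : e * e = e) :
  (forall c, p (i c) = c) -> retract_elt i p = e ->
  local_ring (contra_end C) <-> local_ring (corner ee).
Proof. by move=> ip eE; case: _ / eE ee => ee; exact: local_contra_end_retract. Qed.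

(** The fixed points of an idempotent endomorphism split it: they form the
    direct summand onto which it projects. *)
Section FixedContramodule.
Variables (R : completeRightLinearType) (D : contramodule R) (f : contra_hom D D).
Hypothesis ff : forall d, f (f d) = f d.

Definition fixed : Type := {d : D | f d = d}.

Lemma fixed_eq (c d : fixed) : sval c = sval d -> c = d.
Proof. by case: c d => [x px] [y py] /= xy; exact: eq_exist. Qed.

Lemma fixed_actionP (t : formal_sum R fixed) :
  f (contraaction (formal_sum_map sval t)) = contraaction (formal_sum_map sval t).
Proof.
rewrite contra_homP formal_sum_map_comp.
by congr (contraaction (formal_sum_map _ t)); apply/funext => -[].
Qed.

Definition fixed_action (t : formal_sum R fixed) : fixed :=
  exist _ (contraaction (formal_sum_map sval t)) (fixed_actionP t).

Fact fixed_actionA t :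
  fixed_action (formal_sum_map fixed_action t) = fixed_action (formal_sum_join t).
Proof.
apply: fixed_eq => /=; rewrite formal_sum_join_natural -contraactionA.
by rewrite !formal_sum_map_comp.
Qed.

Fact fixed_action_unit c : fixed_action (formal_sum_unit R c) = c.
Proof. by apply: fixed_eq; rewrite /= formal_sum_map_unit contraaction_unit. Qed.

Definition fixed_contramodule : contramodule R :=
  Contramodule fixed_actionA fixed_action_unit.

Definition fixed_incl : contra_hom fixed_contramodule D :=
  @ContraHom R fixed_contramodule D sval (fun t => erefl).

Definition fixed_image (d : D) : fixed_contramodule := exist _ (f d) (ff d).

Lemma fixed_imageP (t : formal_sum R D) :
  fixed_image (contraaction t) = contraaction (formal_sum_map fixed_image t).
Proof. by apply: fixed_eq; rewrite /= contra_homP formal_sum_map_comp. Qed.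

Definition fixed_proj : contra_hom D fixed_contramodule := ContraHom fixed_imageP.

Lemma fixed_inclK c : fixed_proj (fixed_incl c) = c.
Proof. by apply: fixed_eq; exact: svalP c. Qed.
End FixedContramodule.

(** * Coproduct decompositions and orthogonal idempotents *)

Lemma has_sum_infsum (R : completeRightLinearType) X (r : X -> R) :
  zero_convergent r -> has_sum r (infsum r).
Proof. by move=> /has_sum_ex h; exact: (xgetPex 0 h). Qed.

Lemma infsum_has_sum (R : completeRightLinearType) X (r : X -> R) s :
  zero_convergent r -> has_sum r s -> infsum r = s.
Proof.
move=> zr hs; apply: infsum_eq => // I oI.
have [B hB] := (zero_convergentP _).1 zr I oI; exists B => //.
by rewrite -opprB; apply: oriN => //; exact: has_sum_near.
Qed.

Section CoproductProjections.
Variables (R : completeRightLinearType) (Z : Type) (C : Z -> contramodule R).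
Variables (D : contramodule R) (inj : forall z, contra_hom (C z) D).
Hypothesis cop : is_coproduct inj.

Lemma coproduct_ext (E : contramodule R) (g h : contra_hom D E) :
  (forall z c, g (inj z c) = h (inj z c)) -> g =1 h.
Proof.
move=> gh; have [k [_ uniq_k]] := cop (fun z => contra_comp h (inj z)).
by rewrite -(uniq_k g gh) -(uniq_k h).
Qed.

(** The homomorphism induced by the identity at [z] and by zero elsewhere. *)
Lemma coproduct_proj z : exists p : contra_hom D (C z),
  (forall c, p (inj z c) = c) /\
  forall w c, w <> z -> p (inj w c) = contra0 (C z).
Proof.
pose cast w (wz : w = z) : contra_hom (C w) (C z) :=
  match wz with erefl => contra_end1 (C w) end.
pose delta w : contra_hom (C w) (C z) :=
  if pselect (w = z) is left wz then cast w wz else ContraHom (@contra_hom_zeroP R _ _).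
have [p [pE _]] := cop delta; exists p; split=> [c|w c wz]; rewrite pE /delta.
  by case: pselect => // zz; rewrite (Prop_irrelevance zz erefl).
by case: pselect.
Qed.
End CoproductProjections.

Section CoproductIdempotents.
Variables (R : completeRightLinearType) (Z : Type) (C : Z -> contramodule R).
Variables (inj : forall z, contra_hom (C z) (free1 R)).
Variables (proj : forall z, contra_hom (free1 R) (C z)).
Hypothesis cop : is_coproduct inj.
Hypothesis injK : forall z c, proj z (inj z c) = c.
Hypothesis inj0 : forall z w c, w <> z -> proj z (inj w c) = contra0 (C z).

Definition coproduct_elt z := retract_elt (inj z) (proj z).
Local Notation e := coproduct_elt.

Lemma coef_contra0_free X x : coef (contra0 (free_contramodule R X)) x = 0.
Proof.
rewrite coef_formal_sum_join -[RHS](infsum0 R (formal_sum R X)).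
by congr infsum; apply/funext => s; rewrite /= mul0r.
Qed.

Lemma coproduct_elt_ortho z w : z <> w -> e z * e w = 0.
Proof.
move=> zw; rewrite -coef_retract inj0 // contra_hom0.
exact: coef_contra0_free.
Qed.

(** The universal property provides [g] from [R] to the free contramodule on [Z]
    with [g x = x z] on the summand at [z].  The formal sum [t = g 1] has
    coefficients [e z], as [g] followed by the coordinate [z] is the projection
    onto the summand at [z]; this is where zero-convergence comes from.  The sum
    is [1] since [g] followed by the map sending all generators to [1] is the
    identity on each summand. *)
Lemma coproduct_elt_sum : zero_convergent e /\ has_sum e 1.
Proof.
have [g [gE _]] := cop (fun z =>
  contra_comp (free_ext (fun _ : unit => formal_sum_unit R z : free_contramodule R Z)) (inj z)).
pose t := g (free1_elt 1).
have extE (a : Z -> free1 R) w c :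
    coef (free_ext a (g (inj w c))) tt = coef (inj w c) tt * coef (a w) tt.
  rewrite gE -[X in free_ext a X]/(free_ext (fun=> formal_sum_unit R w : free_contramodule R Z) (inj w c)).
  rewrite free_ext_comp coef_free_ext (@infsum_single R _ tt) ?free_ext_unit //.
  by case.
have tE z : coef t z = e z.
  pose a w : free1 R := free1_elt (if `[< w = z >] then 1 else 0).
  transitivity (coef (free_ext a t) tt).
    rewrite coef_free_ext (@infsum_single R _ z) /=; first by rewrite asboolT ?mulr1.
    by move=> w wz; case: asboolP => // _; rewrite mulr0.
  congr (coef _ tt); apply: (coproduct_ext cop
    (g := contra_comp (free_ext a) g) (h := contra_comp (inj z) (proj z))) => w c.
  rewrite -[LHS]/(free_ext a (g (inj w c))) -[RHS]/(inj z (proj z (inj w c))).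
  apply: free1_eq; rewrite extE /=; case: asboolP => [<-|wz]; first by rewrite injK mulr1.
  by rewrite inj0 // contra_hom0 coef_contra0_free mulr0.
have eE : e = coef t by apply/funext.
have ze : zero_convergent e by rewrite eE; exact: coef_zero_convergent.
split=> //; suff <- : infsum e = 1 by exact: has_sum_infsum.
pose a (_ : Z) : free1 R := free1_elt 1.
transitivity (coef (free_ext a t) tt).
  by rewrite coef_free_ext eE; congr infsum; apply/funext => z; rewrite /= mulr1.
transitivity (coef (free1_elt (1 : R)) tt) => //.
congr (coef _ tt); apply: (coproduct_ext cop
  (g := contra_comp (free_ext a) g) (h := contra_end1 _)) => w c.
rewrite -[LHS]/(free_ext a (g (inj w c))) -[RHS]/(inj w c).
by apply: free1_eq; rewrite extE /= mulr1.
Qed.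
End CoproductIdempotents.

Section IdempotentCoproduct.
Variables (R : completeRightLinearType) (Z : Type) (e : Z -> R).
Hypothesis ee : forall z, e z * e z = e z.
Hypothesis ze : zero_convergent e.
Hypothesis e0 : forall z w, z <> w -> e z * e w = 0.
Hypothesis e1 : has_sum e 1.

Lemma right_mul_idem z d : right_mul (e z) (right_mul (e z) d) = right_mul (e z) d.
Proof. by apply: free1_eq; rewrite !coef_right_mul -mulrA ee. Qed.

Definition left_summand z := fixed_contramodule (right_mul (e z)).
Definition left_summand_incl z : contra_hom (left_summand z) (free1 R) := fixed_incl _.
Definition left_summand_proj z : contra_hom (free1 R) (left_summand z) :=
  fixed_proj (right_mul_idem z).

Lemma left_summand_inclK z c : left_summand_proj z (left_summand_incl z c) = c.
Proof. exact: fixed_inclK. Qed.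

Lemma left_summand_elt z : left_summand_incl z (left_summand_proj z (free1_elt 1)) = free1_elt (e z).
Proof. by apply: free1_eq; rewrite [LHS]coef_right_mul mul1r. Qed.

(** The value at [1] of the induced homomorphism is forced, as [1] is the sum of
    the [e z * e z], the contraaction of the formal sum [t] of the [e z] applied
    to the elements [e z] of the summands. *)
Lemma left_summand_coproduct : is_coproduct left_summand_incl.
Proof.
move=> E f; pose one z := left_summand_proj z (free1_elt 1).
pose a z : E := f z (one z).
pose t : free_contramodule R Z := FormalSum ze.
have free_c x : free_ext (fun _ : unit => x) (free1_elt 1) = x :> E.
  by rewrite -formal_sum_unit_tt free_ext_unit.
exists (free_ext (fun=> free_ext a t)); split=> [z c|g gE].
  pose g := free_ext (fun _ : unit => free_ext a t).
  rewrite -[c]left_summand_inclK; move: (left_summand_incl z c).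
  apply: (contra_hom_free1_eq
    (f := contra_comp g (contra_comp (left_summand_incl z) (left_summand_proj z)))
    (g := contra_comp (f z) (left_summand_proj z))).
  rewrite -[LHS]/(g (left_summand_incl z (one z))) -[RHS]/(a z) /one left_summand_elt /g.
  rewrite -(free_ext_comp (free_ext a) (fun _ : unit => t)).
  (* Orthogonality: multiplying the formal sum of all [e w] by [e z] leaves only
     the term at [z]. *)
  have -> : free_ext (fun _ : unit => t) (free1_elt (e z)) =
            free_ext (fun _ : unit => formal_sum_unit R z : free_contramodule R Z)
              (free1_elt (e z)).
    apply: formal_sum_eq => w; rewrite !coef_free_ext; congr infsum.
    apply/funext => -[] /=; case: asboolP => [->|wz]; first by rewrite ee mulr1.
    by rewrite mulr0 e0 // => zw; apply: wz.
  rewrite free_ext_comp (_ : (fun _ => _) = fun=> a z); last first.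
    by apply/funext => -[]; rewrite free_ext_unit.
  rewrite /a -(free_ext_comp (f z) (fun=> one z)) -left_summand_elt.
  rewrite -[X in free_ext _ (_ X)]/(one z); congr (f z _).
  by rewrite (free_ext_const (left_summand_proj z)) left_summand_inclK.
apply: contra_hom_eq; apply: contra_hom_free1_eq; rewrite free_c.
have -> : free1_elt 1 = free_ext (fun z => left_summand_incl z (one z)) t.
  apply: free1_eq; rewrite coef_free_ext -[LHS]/(1 : R) -(infsum_has_sum ze e1).
  by congr infsum; apply/funext => z; rewrite /one left_summand_elt /= ee.
rewrite free_ext_comp; congr (free_ext _ t).
by apply/funext => z; rewrite gE.
Qed.
End IdempotentCoproduct.

Lemma coproduct_iff_idempotents (R : completeRightLinearType) :
  (exists (Z : Type) (C : Z -> contramodule R)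
          (inj : forall z : Z, contra_hom (C z) (free_contramodule R unit)),
     is_coproduct inj /\ forall z : Z, local_ring (contra_end (C z))) <->
  (exists (Z : Type) (e : Z -> R) (ee : forall z : Z, e z * e z = e z),
     zero_convergent e /\ (forall z w : Z, z <> w -> e z * e w = 0) /\
     has_sum e 1 /\ forall z : Z, local_ring (corner (ee z))).
Proof.
split=> [[Z [C [inj [cop loc]]]]|[Z [e [ee [ze [e0 [e1 loc]]]]]]].
  pose proj z := sval (cid (coproduct_proj cop z)).
  have projP z := svalP (cid (coproduct_proj cop z)).
  have injK z c : proj z (inj z c) = c by case: (projP z).
  have inj0 z w c : w <> z -> proj z (inj w c) = contra0 (C z) by case: (projP z) => _; apply.
  have [ze e1] := coproduct_elt_sum cop injK inj0.
  exists Z, (coproduct_elt inj proj), (fun z => retract_elt_idem (injK z)).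
  split=> //; split; first exact: coproduct_elt_ortho inj0.
  split=> // z; exact: (local_contra_end _ (injK z) erefl).1.
exists Z, (left_summand e), (left_summand_incl e).
split=> [|z]; first exact: left_summand_coproduct ee ze e0 e1.
have elt : retract_elt (left_summand_incl e z) (left_summand_proj ee z) = e z.
  by rewrite /retract_elt left_summand_elt.
exact: (local_contra_end (ee z) (@left_summand_inclK _ _ _ ee z) elt).2 (loc z).
Qed.

(** * Direct summands of a topological ring as a right module *)

Section Topology.
Variables (S : choiceType) (T : topologicalType) (f : S -> T).

Lemma nbhs_initialP (s : initial_topology f) (U : set S) :
  nbhs s U <-> exists2 V, nbhs (f s) V & f @^-1` V `<=` U.
Proof.
split=> [[_ [[V oV <-] Vs VU]]|[V + VU]].
  by exists V => //; apply: open_nbhs_nbhs.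
rewrite nbhsE => -[O [oO Os] OV]; exists (f @^-1` O).
by split=> // [|x /OV /VU //]; exists O.
Qed.

Lemma cvg_initial (X : Type) (F : set_system X) (g : X -> S) (s : initial_topology f) :
  Filter F -> f \o g @ F --> f s -> g @ F --> s.
Proof.
move=> FF h U /nbhs_initialP[V Vs VU].
have FV : F ((f \o g) @^-1` V) := h V Vs.
by change (F (g @^-1` U)); apply: filterS FV => x; exact: VU.
Qed.

End Topology.

Lemma cvg_prod_topology (Z : Type) (T : Z -> topologicalType) (X : Type)
    (F : set_system X) (g : X -> prod_topology T) (x : prod_topology T) :
  Filter F -> (forall z, (fun y => g y z) @ F --> x z) -> g @ F --> x.
Proof.
move=> FF h; apply/cvg_sup => z; apply: (cvg_initial (f := @proj _ _ z)).
exact: h.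
Qed.

Lemma coord_continuous (Z : Type) (T : Z -> topologicalType) z :
  continuous (fun m : prod_topology T => m z).
Proof. exact: (@proj_continuous {classic Z} T z). Qed.

Lemma lmul_continuous (R : topPzRingType) (a : R) : continuous (fun t : R => a * t).
Proof.
move=> x; apply: (@continuous_comp _ _ _ (fun t : R => (a, t)) (fun x : R * R => x.1 * x.2)).
  by apply: cvg_pair => /=; [exact: cvg_cst|exact: cvg_id].
exact: ring_mul_continuous.
Qed.

Record continuous_hom (R : topPzRingType) (M N : topRightModule R) := ContinuousHom {
  continuous_hom_fun :> M -> N;
  continuous_homD : forall m n, continuous_hom_fun (m + n) =
                                continuous_hom_fun m + continuous_hom_fun n;
  continuous_hom_ract : forall m (a : R), continuous_hom_fun (ract m a) =
                                          ract (continuous_hom_fun m) a;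
  continuous_hom_continuous : continuous continuous_hom_fun
}.

Section ContinuousRetract.
Variables (R : completeRightLinearType) (M : topRightModule R).
Variables (i : continuous_hom M (right_regular R)) (p : continuous_hom (right_regular R) M).
Hypothesis ip : forall m, p (i m) = m.

Lemma retract_incl_ract m (a : R) : i (ract m a) = (i m : R) * a.
Proof. exact: continuous_hom_ract. Qed.

Lemma retract_proj_ract (r a : R) : p (r * a) = ract (p r) a.
Proof. exact: (continuous_hom_ract p). Qed.

(** The endomorphism [i \o p] of [R] is a left multiplication. *)
Lemma retract_idemE (r : R) : i (p r) = (i (p 1) : R) * r.
Proof. by rewrite -retract_incl_ract -retract_proj_ract mul1r. Qed.

Variables (e : R) (ee : e * e = e).
Hypothesis eE : i (p 1) = e.

Lemma corner_endD (x : R) m n : p (x * i (m + n)) = p (x * i m) + p (x * i n).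
Proof. by rewrite continuous_homD mulrDr (continuous_homD p). Qed.

Lemma corner_end_ract (x : R) m (a : R) : p (x * i (ract m a)) = ract (p (x * i m)) a.
Proof. by rewrite retract_incl_ract mulrA retract_proj_ract. Qed.

Lemma corner_end_continuous (x : R) : continuous (fun m => p (x * i m)).
Proof.
move=> m; apply: (@continuous_comp _ _ _ (fun m => x * i m : R) p).
  apply: (@continuous_comp _ _ _ i (fun t : R => x * t)); last exact: lmul_continuous.
  exact: continuous_hom_continuous.
exact: continuous_hom_continuous.
Qed.

Definition corner_end (x : corner ee) : continuous_end M :=
  ContinuousEnd (corner_endD (sval x)) (corner_end_ract (sval x))
    (@corner_end_continuous (sval x)).

Lemma end_corner_subproof (f : continuous_end M) :
  exists r, i (f (p 1)) = e * r * e.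
Proof.
apply: in_corner; first by rewrite -eE -retract_idemE ip.
by rewrite -retract_incl_ract -continuous_end_ract -retract_proj_ract mul1r -eE ip.
Qed.

Definition end_corner (f : continuous_end M) : corner ee :=
  exist _ (i (f (p 1)) : R) (end_corner_subproof f).

Lemma corner_endK : cancel corner_end end_corner.
Proof.
by move=> x; apply: corner_eq; rewrite /= retract_idemE eE cornerr cornerl.
Qed.

Lemma end_cornerK : cancel end_corner corner_end.
Proof.
move=> f; apply: continuous_end_eq => m /=.
by rewrite -retract_incl_ract -continuous_end_ract -retract_proj_ract mul1r !ip.
Qed.

(** Endomorphisms of [e R] are the left multiplications by elements of [e R e],
    in the same order of products. *)
Lemma local_continuous_end : local_ring (continuous_end M) <-> local_ring (corner ee).
Proof.
apply: iff_sym; apply: (local_ring_iso corner_endK end_cornerK).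
- apply: continuous_end_eq => m /=.
  by rewrite -eE -retract_idemE !ip.
- move=> x y; suff E u v : corner_end (u + v) = corner_end u + corner_end v.
    have -> : corner_end x = corner_end (x - y) + corner_end y by rewrite -E subrK.
    by rewrite addrK.
  by apply: continuous_end_eq => m /=; rewrite mulrDl (continuous_homD p).
- move=> x y; apply: continuous_end_eq => m /=.
  by rewrite retract_idemE eE !mulrA cornerr.
Qed.
End ContinuousRetract.

Lemma additive_subgroupD (M : zmodType) (I : set M) (x y : M) :
  additive_subgroup I -> I x -> I y -> I (x + y).
Proof.
move=> [I0 IB] Ix Iy; rewrite -[y]opprK; apply: (IB _ _ Ix).
by rewrite -[- y]add0r; exact: IB.
Qed.

Lemma additive_coset (M : zmodType) (I : set M) (x y : M) : additive_subgroup I ->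
  coset I x = coset I y <-> I (x - y).
Proof.
move=> sI; have [I0 IB] := sI; split=> [xy|Ixy].
  have : coset I x x by exists 0 => //; rewrite addr0.
  by rewrite xy => -[i Ii <-]; rewrite addrAC subrr add0r.
have Iyx : I (y - x) by rewrite -opprB -[- _]add0r; exact: IB.
apply/seteqP; split=> _ [i Ii <-].
  by exists (x - y + i); [exact: additive_subgroupD|rewrite addrA subrKC].
by exists (y - x + i); [exact: additive_subgroupD|rewrite addrA subrKC].
Qed.

Section RightSummand.
Variables (R : completeRightLinearType) (e : R).

Definition right_summand : Type := {x : R | e * x = x}.
Local Notation eR := right_summand.

HB.instance Definition _ := gen_eqMixin eR.
HB.instance Definition _ := gen_choiceMixin eR.

Lemma right_summand_eq (x y : eR) : sval x = sval y -> x = y.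
Proof. by case: x y => [x px] [y py] /= xy; exact: eq_exist. Qed.

Lemma right_summandE (x : eR) : e * sval x = sval x.
Proof. by case: x. Qed.

Fact right_summand0_subproof : e * 0 = 0. Proof. exact: mulr0. Qed.
Fact right_summandD_subproof (x y : eR) : e * (sval x + sval y) = sval x + sval y.
Proof. by rewrite mulrDr !right_summandE. Qed.
Fact right_summandN_subproof (x : eR) : e * (- sval x) = - sval x.
Proof. by rewrite mulrN right_summandE. Qed.
Fact right_summand_ract_subproof (x : eR) a : e * (sval x * a) = sval x * a.
Proof. by rewrite mulrA right_summandE. Qed.

Definition right_summand0 : eR := exist _ 0 right_summand0_subproof.
Definition right_summandD x y : eR := exist _ _ (right_summandD_subproof x y).
Definition right_summandN x : eR := exist _ _ (right_summandN_subproof x).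
Definition right_summand_ract (x : eR) (a : R) : eR :=
  exist _ _ (right_summand_ract_subproof x a).

Fact right_summandDA : associative right_summandD.
Proof. by move=> x y z; apply: right_summand_eq; rewrite /= addrA. Qed.
Fact right_summandDC : commutative right_summandD.
Proof. by move=> x y; apply: right_summand_eq; rewrite /= addrC. Qed.
Fact right_summand0D : left_id right_summand0 right_summandD.
Proof. by move=> x; apply: right_summand_eq; rewrite /= add0r. Qed.
Fact right_summandND : left_inverse right_summand0 right_summandN right_summandD.
Proof. by move=> x; apply: right_summand_eq; rewrite /= addNr. Qed.

HB.instance Definition _ := GRing.isZmodule.Build eR
  right_summandDA right_summandDC right_summand0D right_summandND.

HB.instance Definition _ := Topological.copy eR (initial_topology (sval : eR -> R)).

Lemma sval_continuous : continuous (sval : eR -> R).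
Proof. exact: initial_continuous. Qed.

Fact right_summand_sub_continuous : continuous (fun x : eR * eR => x.1 - x.2).
Proof.
move=> x; apply: (cvg_initial (f := sval : eR -> R)).
apply: (@continuous_comp _ _ _ (fun x : eR * eR => (sval x.1, sval x.2))
  (fun x : R * R => x.1 - x.2)); last exact: sub_continuous.
apply: cvg_pair; apply: continuous_comp; try exact: sval_continuous.
  exact: cvg_fst.
exact: cvg_snd.
Qed.

HB.instance Definition _ :=
  PreTopologicalNmodule_isTopologicalZmodule.Build eR right_summand_sub_continuous.

Fact right_summand_ractA m a b :
  right_summand_ract (right_summand_ract m a) b = right_summand_ract m (a * b).
Proof. by apply: right_summand_eq; rewrite /= mulrA. Qed.
Fact right_summand_ract1 m : right_summand_ract m 1 = m.
Proof. by apply: right_summand_eq; rewrite /= mulr1. Qed.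
Fact right_summand_ractDl (m n : eR) a :
  right_summand_ract (m + n) a = right_summand_ract m a + right_summand_ract n a.
Proof. by apply: right_summand_eq; rewrite /= mulrDl. Qed.
Fact right_summand_ractDr m a b :
  right_summand_ract m (a + b) = right_summand_ract m a + right_summand_ract m b.
Proof. by apply: right_summand_eq; rewrite /= mulrDr. Qed.

Fact right_summand_ract_continuous :
  continuous (fun x : eR * R => right_summand_ract x.1 x.2).
Proof.
move=> x; apply: (cvg_initial (f := sval : eR -> R)).
apply: (@continuous_comp _ _ _ (fun x : eR * R => (sval x.1, x.2))
  (fun x : R * R => x.1 * x.2)); last exact: ring_mul_continuous.
apply: cvg_pair; last exact: cvg_snd.
by apply: continuous_comp; [exact: cvg_fst|exact: sval_continuous].
Qed.

Definition open_right_submodule : set (set eR) :=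
  [set N | open N /\ submodule right_summand_ract N].

Lemma trace_open_right_submodule I : open_right_ideal I ->
  open_right_submodule (sval @^-1` I).
Proof.
move=> [oI [[I0 IB] IM]]; split; first by exists I.
split; last by move=> m a; exact: IM.
by split=> // x y; exact: IB.
Qed.

Lemma open_right_submodule_base (U : set eR) : nbhs (0 : eR) U ->
  exists2 I : set R, open_right_ideal I & sval @^-1` I `<=` U.
Proof.
move=> /nbhs_initialP[V /open_right_ideal_base[I oI IV] VU].
by exists I => // x /IV /VU.
Qed.

(** A compatible family of cosets is represented by elements [mI I] of [e R],
    which give a compatible family in [R], hence a limit [s] there.  Left
    multiplication by [e] is continuous and fixes the [mI I], so [e s] is a limit
    too, and [e s = s] by separation. *)
Lemma right_summand_complete_separated : complete_separated open_right_submodule.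
Proof.
split=> [m _|m n _ _ mn|c [c1 c2]].
- split=> [I|I J IJ]; first by exists m.
  by move=> _ [x Ix <-]; exists x => //; exact: IJ.
- apply: right_summand_eq; apply: ori_separated => I oI.
  have oN := trace_open_right_submodule oI.
  move/(congr1 (fun f => f (exist _ _ oN))): mn => /= /additive_coset; apply.
  by case: oN => _ [].
have coh I J : sval I `<=` sval J -> forall m n, c I = coset (sval I) m ->
    c J = coset (sval J) n -> sval J (m - n).
  move=> IJ m n cI cJ; have [_ [sJ _]] := svalP J; have [_ [[I0 _] _]] := svalP I.
  have : c I m by rewrite cI; exists 0 => //; rewrite addr0.
  by move/(c2 _ _ IJ); rewrite cJ => -[j Jj <-]; rewrite addrAC subrr add0r.
pose tr (I : {I | open_right_ideal (R := R) I}) : {N | open_right_submodule N} :=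
  exist _ _ (trace_open_right_submodule (svalP I)).
pose mI I : eR := sval (cid (c1 (tr I))).
have mIE I : c (tr I) = coset (sval (tr I)) (mI I) := svalP (cid (c1 (tr I))).
have mIB I J : sval I `<=` sval J -> sval J (sval (mI I) - sval (mI J)).
  by move=> IJ; apply: (coh (tr I) (tr J)) => // x; exact: IJ.
have [_ _ surj] := @ring_complete_separated R.
have [s _ sE] : exists2 s, [set: R] s &
    (fun I : {I | open_right_ideal (R := R) I} => coset (sval I) s) =
    (fun I => coset (sval I) (sval (mI I))).
  apply: surj; split=> [I|I J IJ]; first by eexists.
  have [_ [sJ _]] := svalP J.
  have <- := (additive_coset _ _ sJ).2 (mIB _ _ IJ).
  by move=> _ [x Ix <-]; exists x => //; exact: IJ.
have {}sE I : sval I (s - sval (mI I)).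
  apply: coset_ori; first exact: svalP.
  by move/(congr1 (fun f => f I)): sE.
(* The congruence modulo a smaller [J], with [e J] inside [I], survives left
   multiplication by [e] modulo [I]. *)
have es I : sval I (e * s - sval (mI I)).
  have [J oJ JI] := ori_lmul e (svalP I).
  have oIJ : open_right_ideal (sval I `&` J).
    have [oI [[I0 IB] IM]] := svalP I; case: oJ => oJ [[J0 JB] JM].
    split; first exact: openI.
    split; last by move=> x a [Ix Jx]; split; [exact: IM|exact: JM].
    by split=> // x y [Ix Jx] [Iy Jy]; split; [exact: IB|exact: JB].
  pose IJ : {I | open_right_ideal (R := R) I} := exist _ _ oIJ.
  have h1 : sval I (e * s - sval (mI IJ)).
    by have [_ /JI] := sE IJ; rewrite mulrBr right_summandE.
  have h2 : sval I (sval (mI IJ) - sval (mI I)) by apply: mIB => x [].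
  by have := oriD (svalP I) h1 h2; rewrite addrA subrK.
have ess : e * s = s.
  apply: ori_separated => I oI; pose K : {I | open_right_ideal (R := R) I} := exist _ I oI.
  have := oriB oI (es K) (sE K).
  by rewrite opprB addrA subrK.
pose es' : eR := exist _ s ess.
exists es' => //; apply: functional_extensionality_dep => -[N oN] /=.
have [I oI IN] : exists2 I, open_right_ideal I & sval @^-1` I `<=` N.
  apply: open_right_submodule_base; apply: open_nbhs_nbhs.
  by case: oN => oN [[N0 _] _].
have [m cN] := c1 (exist _ N oN); rewrite cN.
have [_ [sN NM]] := oN; apply/(additive_coset _ _ sN).
pose K : {I | open_right_ideal (R := R) I} := exist _ I oI.
rewrite -(subrKA (mI K)).
apply: additive_subgroupD => //; first by apply: IN; exact: (sE K).
exact: (coh (tr K) (exist _ N oN)).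
Qed.

Lemma right_summand_open_base (U : set eR) : nbhs (0 : eR) U ->
  exists2 N : set eR, open N /\ submodule right_summand_ract N & N `<=` U.
Proof.
move=> /open_right_submodule_base[I oI IU].
by exists (sval @^-1` I) => //; exact: trace_open_right_submodule.
Qed.

Definition right_summand_module : topRightModule R :=
  @TopRightModule R eR right_summand_ract right_summand_ractA right_summand_ract1
    right_summand_ractDl right_summand_ractDr right_summand_ract_continuous
    right_summand_open_base right_summand_complete_separated.

Definition right_summand_incl : continuous_hom right_summand_module (right_regular R) :=
  @ContinuousHom R right_summand_module (right_regular R) sval
    (fun _ _ => erefl) (fun _ _ => erefl) sval_continuous.

Hypothesis ee : e * e = e.

Fact right_summand_proj_subproof (r : R) : e * (e * r) = e * r.
Proof. by rewrite mulrA ee. Qed.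

Definition right_summand_image (r : R) : right_summand_module :=
  exist _ _ (right_summand_proj_subproof r).

Fact right_summand_imageD (r s : R) :
  right_summand_image (r + s) = right_summand_image r + right_summand_image s.
Proof. by apply: right_summand_eq; rewrite /= mulrDr. Qed.

Fact right_summand_image_ract (r a : R) :
  right_summand_image (r * a) = ract (right_summand_image r) a.
Proof. by apply: right_summand_eq; rewrite /= mulrA. Qed.

Fact right_summand_image_continuous : continuous right_summand_image.
Proof.
move=> x; apply: (cvg_initial (f := sval : eR -> R)).
exact: lmul_continuous.
Qed.

Definition right_summand_proj : continuous_hom (right_regular R) right_summand_module :=
  @ContinuousHom R (right_regular R) right_summand_module right_summand_image
    right_summand_imageD right_summand_image_ract right_summand_image_continuous.

Lemma right_summand_inclK m : right_summand_proj (right_summand_incl m) = m.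
Proof. by apply: right_summand_eq; exact: right_summandE. Qed.

End RightSummand.

(** * Product decompositions and orthogonal idempotents *)

(** A term outside a large finite set is a difference of two partial sums. *)
Lemma has_sum_zero_convergent (R : completeRightLinearType) X (r : X -> R) s :
  has_sum r s -> zero_convergent r.
Proof.
move=> /has_sumP hs; apply/zero_convergentP => I oI.
have [B hB] := hs I oI; exists B => x xB.
have h1 := hB _ (fsubset_refl B).
have h2 := hB _ (fsubsetU1 x B).
have := oriB oI h2 h1.
by rewrite big_fsetU1 //= opprB addrA subrK addrK.
Qed.

Section IdempotentProduct.
Variables (R : completeRightLinearType) (Z : Type) (e : Z -> R).
Hypothesis ee : forall z, e z * e z = e z.
Hypothesis ze : zero_convergent e.
Hypothesis e0 : forall z w, z <> w -> e z * e w = 0.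
Hypothesis e1 : has_sum e 1.

(** The inverse map is summation.  It is continuous because, modulo an open right
    ideal [I], only the finitely many coordinates with [e z] outside [I] matter. *)
Lemma idempotents_direct_product :
  is_direct_product (fun z => right_summand_proj (ee z) : right_regular R -> _).
Proof.
split=> [z m n|z m a|F].
- exact: right_summand_imageD.
- exact: right_summand_image_ract.
pose G (m : prod_topology (fun z => right_summand_module (e z) : topologicalType)) : R :=
  infsum (fun z => sval (m z)).
have zc (m : forall z, right_summand_module (e z)) : zero_convergent (fun z => sval (m z)).
  rewrite (_ : (fun z => _) = fun z => e z * sval (m z)); first exact: zero_convergentMr.
  by apply/funext => z; rewrite right_summandE.
exists G; split.
- move=> r; rewrite /G /F /= infsumMr // (infsum_has_sum ze e1); exact: mul1r.
- move=> m; apply: functional_extensionality_dep => z; apply: right_summand_eq.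
  rewrite /F /G /= -infsumMl; last exact: zc.
  rewrite (@infsum_single R _ z) ?right_summandE // => w wz.
  rewrite -right_summandE mulrA e0 ?mul0r //.
  by move=> zw; apply: wz.
- move=> r; apply: cvg_prod_topology => z.
  exact: (@right_summand_image_continuous R (e z) (ee z) r).
move=> m U Um; have [I oI IU] := ori_base Um.
have [B hB] := (zero_convergentP _).1 ze I oI.
have near_z z : nbhs m [set m' | I (sval (m' z) - sval (m z))].
  have c : {for m, continuous (fun m' : prod_topology (fun z => right_summand_module (e z) : topologicalType) => sval (m' z) : R)}.
    apply: (@continuous_comp _ _ _ (fun m' : prod_topology
      (fun z => right_summand_module (e z) : topologicalType) => m' z)
      (sval : right_summand (e z) -> R)).
      exact: coord_continuous.
    exact: sval_continuous.
  exact: (c _ (ori_nbhs oI (sval (m z)))).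
have near_B := @filter_bigI _ _ B _ _ (nbhs_filter m) (fun z _ => near_z z).
change (nbhs m (G @^-1` U)); apply: filterS near_B => m' m'B; apply: IU; rewrite /G.
rewrite -infsumN; last exact: zc.
rewrite -infsumD; [|exact: zc|by apply: zero_convergentN; exact: zc].
apply: ori_infsum => // [|z].
  by apply: zero_convergentD; [exact: zc|apply: zero_convergentN; exact: zc].
have [zB|/hB ez] := boolP ((z : {classic Z}) \in B); first exact: m'B.
by apply: oriB => //; rewrite -right_summandE; exact: oriM.
Qed.
End IdempotentProduct.

Section ProductIdempotents.
Variables (R : completeRightLinearType) (Z : Type) (M : Z -> topRightModule R).
Variable p : forall z, right_regular R -> M z.
Hypothesis pD : forall z m n, p z (m + n) = p z m + p z n.
Hypothesis pM : forall z m (a : R), p z (ract m a) = ract (p z m) a.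
Let F : right_regular R -> prod_topology (fun z => M z : topologicalType) :=
  fun n z => p z n.
Variable G : prod_topology (fun z => M z : topologicalType) -> right_regular R.
Hypothesis FK : cancel F G.
Hypothesis GK : cancel G F.
Hypothesis F_continuous : continuous F.
Hypothesis G_continuous : continuous G.

Lemma product_projK m z : p z (G m) = m z.
Proof. by rewrite -[LHS]/(F (G m) z) GK. Qed.

Lemma product_ext r s : (forall z, p z r = p z s) -> r = s.
Proof.
move=> rs; rewrite -[r]FK -[s]FK; congr G.
by apply: functional_extensionality_dep => z; exact: rs.
Qed.

Lemma product_proj_continuous z : continuous (p z).
Proof.
move=> r; apply: (@continuous_comp _ _ _ F (fun m => m z)); first exact: F_continuous.
exact: coord_continuous.
Qed.

Definition product_proj z : continuous_hom (right_regular R) (M z) :=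
  ContinuousHom (@pD z) (@pM z) (@product_proj_continuous z).

Definition axis z (m : M z) : prod_topology (fun z => M z : topologicalType) :=
  @dfwith {classic Z} M (fun w => 0) z m.

Lemma axis_same z m : axis m z = m.
Proof. exact: dfwithin. Qed.

Lemma axis_other z w (m : M z) : z <> w -> axis m w = 0.
Proof. by move=> zw; apply: dfwithout; apply/eqP. Qed.

Lemma product_proj_axis_same z (m : M z) : p z (G (axis m)) = m.
Proof. by rewrite product_projK axis_same. Qed.

Lemma product_proj_axis_other z w (m : M z) : z <> w -> p w (G (axis m)) = 0.
Proof. by move=> zw; rewrite product_projK axis_other. Qed.

Lemma product_inclD z (m n : M z) : G (axis (m + n)) = G (axis m) + G (axis n).
Proof.
apply: product_ext => w; rewrite pD.
have [<-|zw] := pselect (z = w); first by rewrite !product_proj_axis_same.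
by rewrite !product_proj_axis_other // addr0.
Qed.

Lemma product_incl_ract z (m : M z) (a : R) : G (axis (ract m a)) = ract (G (axis m)) a.
Proof.
apply: product_ext => w; rewrite pM.
have [<-|zw] := pselect (z = w); first by rewrite !product_proj_axis_same.
by rewrite !product_proj_axis_other // ract0.
Qed.

Lemma product_incl_continuous z : continuous (fun m : M z => G (axis m)).
Proof.
move=> m; apply: (@continuous_comp _ _ _ (@axis z) G); last exact: G_continuous.
exact: (@dfwith_continuous {classic Z} (fun z => M z : topologicalType)).
Qed.

Definition product_incl z : continuous_hom (M z) (right_regular R) :=
  ContinuousHom (@product_inclD z) (@product_incl_ract z) (@product_incl_continuous z).

Lemma product_inclK z m : product_proj z (product_incl z m) = m.
Proof. exact: product_proj_axis_same. Qed.

Definition product_elt z : R := product_incl z (product_proj z 1).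
Local Notation e := product_elt.

Lemma product_elt_mul z (r : R) : e z * r = product_incl z (product_proj z r).
Proof. by rewrite (retract_idemE (product_incl z) (product_proj z)). Qed.

Lemma product_elt_idem z : e z * e z = e z.
Proof. by rewrite product_elt_mul product_inclK. Qed.

Lemma product_elt_ortho z w : z <> w -> e z * e w = 0.
Proof.
move=> zw; rewrite product_elt_mul.
have -> : product_proj z (e w) = 0 by apply: product_proj_axis_other => wz; apply: zw.
by apply: (addrI (product_incl z 0)); rewrite -continuous_homD !addr0.
Qed.

(** The coordinate at [z] of a partial sum over [B] is that of [1] as soon as
    [B] contains [z], so the partial sums converge to [1] coordinatewise. *)
Lemma product_elt_has_sum : has_sum e 1.
Proof.
have p0 z : p z 0 = 0 by apply: (addrI (p z 0)); rewrite -pD !addr0.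
have pS z (B : {fset {classic Z}}) : z \in B ->
    p z (summability.partial_sum (e : {classic Z} -> R) B) = p z 1.
  move=> zB; have -> : summability.partial_sum (e : {classic Z} -> R) B = \sum_(w <- B) e w.
    by rewrite /summability.partial_sum big_seq_fsetE.
  rewrite (big_morph (p z) (@pD z) (p0 z)) (bigD1_seq z) ?fset_uniq //=.
  rewrite big1 => [|w /eqP wz]; last exact: product_proj_axis_other.
  by rewrite addr0; exact: product_proj_axis_same.
rewrite /has_sum -[1 : R](FK 1).
rewrite (_ : summability.partial_sum _ =
  G \o (fun B => F (summability.partial_sum (e : {classic Z} -> R) B))); last first.
  by apply/funext => B; rewrite /= FK.
apply: cvg_comp; last exact: G_continuous.
have filter_tot : Filter (@summability.totally {classic Z}).
  by have [] := @summability.totally_filter {classic Z}.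
apply: cvg_prod_topology => z U Uz.
exists [fset (z : {classic Z})]%fset => // B zB /=; rewrite /F pS.
  exact: nbhs_singleton.
by apply: (fsubsetP zB); rewrite inE.
Qed.

Lemma product_elt_local (loc : forall z, local_ring (continuous_end (M z))) z :
  local_ring (corner (product_elt_idem z)).
Proof.
exact: (local_continuous_end (@product_inclK z) (product_elt_idem z) erefl).1.
Qed.
End ProductIdempotents.

Lemma product_iff_idempotents (R : completeRightLinearType) :
  (exists (Z : Type) (M : Z -> topRightModule R)
          (p : forall z : Z, right_regular R -> M z),
     is_direct_product p /\ forall z : Z, local_ring (continuous_end (M z))) <->
  (exists (Z : Type) (e : Z -> R) (ee : forall z : Z, e z * e z = e z),
     zero_convergent e /\ (forall z w : Z, z <> w -> e z * e w = 0) /\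
     has_sum e 1 /\ forall z : Z, local_ring (corner (ee z))).
Proof.
split=> [[Z [M [p [[pD pM [G [FK GK Fc Gc]]] loc]]]]|[Z [e [ee [ze [e0 [e1 loc]]]]]]].
  have e1 := product_elt_has_sum pD pM FK GK Fc Gc.
  exists Z, (product_elt pD pM FK GK Fc Gc), (product_elt_idem pD pM FK GK Fc Gc).
  split; first exact: has_sum_zero_convergent e1.
  split; first exact: product_elt_ortho.
  by split=> //; exact: product_elt_local.
exists Z, (fun z => right_summand_module (e z)), (fun z => right_summand_proj (ee z)).
split=> [|z]; first exact: idempotents_direct_product.
apply: (local_continuous_end (right_summand_inclK (ee z)) (ee z) _).2 => //.
exact: mulr1.
Qed.

Theorem theorem5p1 (R : completeRightLinearType) :
  let coproduct_of_local :=
    exists (Z : Type) (C : Z -> contramodule R)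
           (inj : forall z : Z, contra_hom (C z) (free_contramodule R unit)),
      is_coproduct inj /\ forall z : Z, local_ring (contra_end (C z)) in
  let product_of_local :=
    exists (Z : Type) (M : Z -> topRightModule R)
           (p : forall z : Z, right_regular R -> M z),
      is_direct_product p /\ forall z : Z, local_ring (continuous_end (M z)) in
  let orthogonal_idempotents :=
    exists (Z : Type) (e : Z -> R) (ee : forall z : Z, e z * e z = e z),
      zero_convergent e /\
      (forall z w : Z, z <> w -> e z * e w = 0) /\
      has_sum e 1 /\
      forall z : Z, local_ring (corner (ee z)) in
  (coproduct_of_local <-> product_of_local) /\
  (product_of_local <-> orthogonal_idempotents).
Proof.
move=> coproduct_of_local product_of_local orthogonal_idempotents.
have prod_idem : product_of_local <-> orthogonal_idempotents := product_iff_idempotents R.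
split=> //; apply: iff_trans (iff_sym prod_idem); exact: coproduct_iff_idempotents.
Qed.
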